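(* Let $(M,\omega)$ be a symplectic manifold of dimension $2n$ and let $K$ be a Haantjes operator compatible with $\omega$, so that in Darboux coordinates $(q,p)=(q^1,\dots,q^n,p_1,\dots,p_n)$ it has the block form $\begin{pmatrix}A&B\\C&A^T\end{pmatrix}$ with $B+B^T=0$, $C+C^T=0$. Suppose $B=0$ (a ''lift-form'' operator), i.e. $$K=\begin{pmatrix}A&0\\ C&A^T\end{pmatrix}.$$ Then: (i) $C$ is skew-symmetric. (ii) The eigenvalues of $K$ coincide with those of $A$: $\det(K-\lambda I)=[\det(A-\lambda I)]^2$. (iii) Any left eigenvector $\sigma$ of $A$ for eigenvalue $\lambda$ gives a position-only left eigenvector $(\sigma,0)$ of $K$ for the same $\lambda$; equivalently, $(\sigma^T,0)^T$ is an eigenvector of $K^T$ for eigenvalue $\lambda$, hence a characteristic $1$-form of $K$, i.e. an element of $\ker(K^T-\lambda I)$. Consequently, for a lift-form Haantjes operator the Darboux--Haantjes coordinates are determined entirely by the $A$-block. Parts (ii) and (iii) provide the position coordinates $Q_i=\lambda_i(q)$ via eigenvalues and characteristic $1$-forms of $A$. The conjugate momenta are recovered via the generating function $F_2=\sum_iP_iQ_i(q)$, which depends on $A$-block data only.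
   Context: For a $(1,1)$ tensor field $L$ on a manifold, the Nijenhuis torsion is $T_L(X,Y)=L^2[X,Y]+[LX,LY]-L([X,LY]+[LX,Y])$ and the Haantjes torsion is $\mathcal H_L(X,Y)=L^2T_L(X,Y)+T_L(LX,LY)-L(T_L(X,LY)+T_L(LX,Y))$; $L$ is a Haantjes operator if $\mathcal H_L\equiv0$. Compatibility of $K$ with $\omega$ means $\Omega K=K^T\Omega$, where $\Omega:TM\to T^*M$ is defined by $\omega(X,Y)=\langle\Omega X,Y\rangle$ and $K^T$ is the transpose of $K$; it implies the block form above. $A,B,C$ are $n\times n$ matrices of functions of $(q,p)$, and matrices are written with respect to the frame $\partial_{q^1},\dots,\partial_{q^n},\partial_{p_1},\dots,\partial_{p_n}$. $\lambda_i$ denote the eigenvalues of $A$. Darboux--Haantjes coordinates $(Q,P)$ are coordinates in which $\omega=\sum_idQ_i\wedge dP_i$ and the Haantjes operator is diagonal. The generating function $F_2(q,P)$ defines the canonical transformation by $p_j=\partial F_2/\partial q^j$, $Q_i=\partial F_2/\partial P_i$.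
   Formalization: The final claim fails for general C and λ_i; here λ_i are smooth in q, the dλ_i independent characteristic 1-forms of A for λ_i; the F_2 coordinates are then Darboux, and Darboux–Haantjes iff C_ij=Σ_k p_k(∂_{q^j}A^k_i−∂_{q^i}A^k_j). *)

(* Defs.v *)
From HB Require Import structures.
From mathcomp Require Import all_boot all_order all_algebra.
From mathcomp Require Import all_classical reals topology normedtype derive.

Set Implicit Arguments.
Unset Strict Implicit.
Unset Printing Implicit Defensive.

Import Order.TTheory GRing.Theory Num.Theory numFieldNormedType.Exports.
Local Open Scope classical_set_scope.
Local Open Scope ring_scope.

(* Points of R^m are row vectors 'rV_m, tangent vectors are column vectors
   'cV_m, covectors are row vectors acting on the left; a (1,1) tensor acts on
   tangent vectors by left multiplication.  *)

Section Calculus.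
Variables (R : realType) (m : nat).
Implicit Types (U : set 'rV[R]_m) (f : 'rV[R]_m -> R).

Definition partial (i : 'I_m) f (x : 'rV[R]_m) : R := 'D_(delta_mx 0 i) f x.

Definition grad f (x : 'rV[R]_m) : 'rV[R]_m := \row_j partial j f x.

(* The levels agree with the classes C^k on open sets. *)
Fixpoint Ck (k : nat) U f : Prop :=
  if k is k'.+1 then
    (forall x, U x -> differentiable f x) /\
    (forall i, Ck k' U (partial i f))
  else forall x, U x -> {for x, continuous f}.

Definition smooth U f : Prop := forall k, Ck k U f.

Definition smooth_mx k l U (F : 'rV[R]_m -> 'M[R]_(k, l)) : Prop :=
  forall i j, smooth U (fun x => F x i j).

(* The library's ['J f x] acts on row vectors; here entry (i, j) is the j-th
   partial derivative of the i-th component. *)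
Definition jac l (f : 'rV[R]_m -> 'rV[R]_l) (x : 'rV[R]_m) : 'M[R]_(l, m) :=
  (jacobian f x)^T.

Definition vector_field := 'rV[R]_m -> 'cV[R]_m.
Definition matrix_field := 'rV[R]_m -> 'M[R]_m.

Definition bracket (X Y : vector_field) : vector_field := fun x =>
  \col_i \sum_j (X x j 0 * partial j (fun y => Y y i 0) x
                 - Y x j 0 * partial j (fun y => X y i 0) x).

Definition act (L : matrix_field) (X : vector_field) : vector_field :=
  fun x => L x *m X x.

Definition nijenhuis (L : matrix_field) (X Y : vector_field) : vector_field :=
  fun x => act L (act L (bracket X Y)) x
           + bracket (act L X) (act L Y) x
           - L x *m (bracket X (act L Y) x + bracket (act L X) Y x).

Definition haantjes (L : matrix_field) (X Y : vector_field) : vector_field :=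
  fun x => act L (act L (nijenhuis L X Y)) x
           + nijenhuis L (act L X) (act L Y) x
           - L x *m (nijenhuis L X (act L Y) x + nijenhuis L (act L X) Y x).

End Calculus.

Section Manifolds.
Variables (R : realType) (m : nat).

(* [cmap] is only meaningful on [cdom], and [cinv] on [cimg] *)
Record chart (M : Type) := Chart {
  cdom : set M;
  cmap : M -> 'rV[R]_m;
  cinv : 'rV[R]_m -> M }.

Definition cimg M (c : chart M) : set 'rV[R]_m := cmap c @` cdom c.

Definition is_chart (M : topologicalType) (c : chart M) : Prop :=
  [/\ open (cdom c), open (cimg c),
      (forall u, cdom c u -> cinv c (cmap c u) = u),
      (forall u, cdom c u -> {for u, continuous (cmap c)})
    & (forall x, cimg c x -> {for x, continuous (cinv c)})].

Definition overlap M (c d : chart M) : set 'rV[R]_m :=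
  cmap c @` (cdom c `&` cdom d).

Definition transition M (c d : chart M) : 'rV[R]_m -> 'rV[R]_m :=
  cmap d \o cinv c.

Definition smoothly_compatible M (c d : chart M) : Prop :=
  smooth_mx (overlap c d) (transition c d) /\
  smooth_mx (overlap d c) (transition d c).

Record manifold := Manifold {
  carrier :> topologicalType;
  atlas : set (chart carrier);
  manifold_hausdorff : hausdorff_space carrier;
  manifold_countable : @second_countable carrier;
  atlas_chart : forall c, atlas c -> is_chart c;
  atlas_cover : forall u : carrier, exists2 c, atlas c & cdom c u;
  atlas_compatible :
    forall c d, atlas c -> atlas d -> smoothly_compatible c d;
  atlas_maximal : forall c, is_chart c ->
    (forall d, atlas d -> smoothly_compatible c d) -> atlas c }.

(* A tensor field is given by its components in all the charts of the maximal
   atlas, subject to the usual transformation law. *)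
Record tensor11 (X : manifold) := Tensor11 {
  tcomp :> chart X -> matrix_field R m;
  tensor11_smooth : forall c, atlas c -> smooth_mx (cimg c) (tcomp c);
  tensor11_law : forall c d x, atlas c -> atlas d -> overlap c d x ->
    tcomp d (transition c d x) *m jac (transition c d) x =
    jac (transition c d) x *m tcomp c x }.

(* The components are w(e_i, e_j) in the coordinate frame e. *)
Record symplectic_form (X : manifold) := SymplecticForm {
  wcomp :> chart X -> matrix_field R m;
  symplectic_smooth : forall c, atlas c -> smooth_mx (cimg c) (wcomp c);
  symplectic_law : forall c d x, atlas c -> atlas d -> overlap c d x ->
    wcomp c x = (jac (transition c d) x)^T *m wcomp d (transition c d x)
                  *m jac (transition c d) x;
  symplectic_skew : forall c x, atlas c -> cimg c x ->
    (wcomp c x)^T = - wcomp c x;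
  symplectic_nondegenerate : forall c x, atlas c -> cimg c x ->
    wcomp c x \in unitmx;
  symplectic_closed : forall c x, atlas c -> cimg c x -> forall i j k,
    partial i (fun y => wcomp c y j k) x + partial j (fun y => wcomp c y k i) x
      + partial k (fun y => wcomp c y i j) x = 0 }.

Definition haantjes_operator (X : manifold) (K : tensor11 X) : Prop :=
  forall c, atlas c -> forall V W : vector_field R m,
    smooth_mx (cimg c) V -> smooth_mx (cimg c) W ->
    forall x, cimg c x -> haantjes (K c) V W x = 0.

(* The matrix of Omega : TM -> T*M, where w(V, W) = <Omega V, W>. *)
Definition Omega (X : manifold) (w : symplectic_form X) (c : chart X) :
  matrix_field R m := fun x => (w c x)^T.

Definition symplectically_compatible (X : manifold) (w : symplectic_form X)
    (K : tensor11 X) : Prop :=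
  forall c x, atlas c -> cimg c x ->
    Omega w c x *m K c x = (K c x)^T *m Omega w c x.

End Manifolds.

Section Eigen.
Variables (R : realType) (m : nat).

Definition left_eigenvector (L : 'M[R]_m) (l : R) (s : 'rV[R]_m) : Prop :=
  s != 0 /\ s *m L = l *: s.

Definition right_eigenvector (L : 'M[R]_m) (l : R) (v : 'cV[R]_m) : Prop :=
  v != 0 /\ L *m v = l *: v.

(* Here the covector is the column of its components. *)
Definition characteristic_covector (L : 'M[R]_m) (l : R) (a : 'cV[R]_m) : Prop :=
  (L^T - l%:M) *m a = 0.

End Eigen.

Section Darboux.
Variables (R : realType) (n : nat) (X : manifold R (n + n)).

(* A point of a chart is (q, p), with q = lsubmx and p = rsubmx; the matrix
   below is that of the sum of the dq^i /\ dp_i. *)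
Definition darboux (w : symplectic_form X) (c : chart R (n + n) X) : Prop :=
  atlas c /\
  forall x, cimg c x -> w c x = block_mx 0 1%:M (- 1%:M) 0.

Definition darboux_haantjes (w : symplectic_form X) (K : tensor11 X)
    (c : chart R (n + n) X) : Prop :=
  darboux w c /\ forall x, cimg c x -> is_diag_mx (K c x).

Definition Ablock (K : tensor11 X) c x : 'M[R]_n := ulsubmx (K c x).
Definition Bblock (K : tensor11 X) c x : 'M[R]_n := ursubmx (K c x).
Definition Cblock (K : tensor11 X) c x : 'M[R]_n := dlsubmx (K c x).

Definition lift_form (K : tensor11 X) c : Prop :=
  forall x, cimg c x -> Bblock K c x = 0.

(* [c] carries (q, p), [d] carries (Q, P), and F = F_2(q, P):
   p_j = dF/dq^j and Q_j = dF/dP_j on the domain of [d]. *)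
Definition generates (F : 'rV[R]_n -> 'rV[R]_n -> R)
    (c d : chart R (n + n) X) : Prop :=
  forall u, cdom d u ->
    let q := lsubmx (cmap c u) in let p := rsubmx (cmap c u) in
    let Q := lsubmx (cmap d u) in let P := rsubmx (cmap d u) in
    forall j, p 0 j = partial j (fun q' => F q' P) q /\
              Q 0 j = partial j (F q) P.

(* The lower left block of the complete lift of A to the cotangent bundle:
   C_ij = \sum_k p_k (d A^k_i / d q^j - d A^k_j / d q^i). *)
Definition complete_lift_block (A : 'rV[R]_(n + n) -> 'M[R]_n)
    (x : 'rV[R]_(n + n)) : 'M[R]_n :=
  \matrix_(i, j) \sum_k rsubmx x 0 k *
    (partial (lshift n j) (fun y => A y k i) x
     - partial (lshift n i) (fun y => A y k j) x).

End Darboux.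

(* Main.v *)
Require Import Defs.
From HB Require Import structures.
From mathcomp Require Import all_boot all_order all_algebra.
From mathcomp Require Import all_classical reals topology normedtype derive.
From mathcomp Require Import landau sequences interval_inference ring lra.
Import Order.TTheory GRing.Theory Num.Theory numFieldNormedType.Exports.
Local Open Scope classical_set_scope.
Local Open Scope ring_scope.

Set Implicit Arguments.
Unset Strict Implicit.
Unset Printing Implicit Defensive.

(* The functions [Q_i = lam_i(q)] and [P = p G^-1], where [G] has the rows
   [grad lam_i], are the coordinates generated by [F_2]; by the inverse function
   theorem they form a chart near the given point.  Differentiating [p = P G]
   shows that the Jacobian of [(q, p) |-> (Q, P)] is [[G, 0], [N, H]] with
   [G^T H = 1] and [G^T N = - \sum_i P_i Hess(lam_i)], which is symmetric; hence
   the chart is a Darboux chart.  In it the diagonal blocks of a lift-form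
   operator become [diag Q], because [G A = diag(lam) G], and the lower left one
   vanishes iff [C = A^T T - T A] with [T = G^T N].  Differentiating
   [G A = diag(lam) G] identifies this matrix with the lower left block of the
   complete lift of [A]. *)

(** * Functions of class C^k *)

Section Differentials.
Variables (R : realType) (V W : normedModType R).
Implicit Types (f g : V -> W) (x : V).

(** The complete lift enters because it is natural under changes of position coordinates, and the
    complete lift of [diag Q] is diagonal: its lower left block is
    [P_i delta_ij - P_j delta_ij = 0]. An operator diagonal in [(Q, P)] must therefore have the
    complete lift block as its [C]; the proof checks this through Hessians instead of developing
    naturality. The chart is built from the functions [lam i] alone, before an operator is chosen,
    so it serves all lift-form operators with the same A-block. The block [C] is the one datum it
    does not control, which is why diagonality appears as an equivalence. Smoothness means iterated
    partial derivatives of scalar components, so everything is phrased with [Ck], which has to be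
    closed under composition and matrix inversion. The inverse function theorem is applied in the
    [n] position variables only: the transformation is linear in [p] on each fibre and is inverted
    there explicitly. *)

Lemma open_near (T : topologicalType) (U : set T) (P : T -> Prop) (x : T) :
  open U -> U x -> (forall y, U y -> P y) -> \forall y \near x, P y.
Proof. by move=> oU Ux UP; exact: filterS (open_nbhs_nbhs (conj oU Ux)). Qed.

(** Epsilon form of Fréchet differentiability: a candidate differential is certified by a plain
    estimate of the remainder. *)
Lemma is_diff_littleo f (df : {linear V -> W}) x : continuous df ->
  (forall e : R, 0 < e ->
    \forall h \near 0, `|f (h + x) - (f x + df h)| <= e * `|h|) ->
  is_diff x f df.
Proof.
move=> cdf fo.
have E : f \o shift x = cst (f x) + df +o_ 0 id by exact/eqaddoP.
have D := diff_unique cdf E.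
apply: DiffDef => //; apply/diff_locallyP; rewrite D; split => //.
Qed.

Lemma near_eq_differentiable f g x :
  (\forall y \near x, f y = g y) -> differentiable f x -> differentiable g x.
Proof.
move=> fg df; have [cdf E] := (diff_locallyP _ _).1 df.
suff : is_diff x g ('d f x) by case.
apply: is_diff_littleo => // e e0.
have /eqaddoP/(_ e e0) Ee := E.
have fg0 : \forall h \near (0 : V), f (h + x) = g (h + x).
  by move: fg; rewrite (near_shift 0) /= subr0; apply: filterS.
rewrite -(nbhs_singleton fg).
by apply: filterS2 fg0 Ee => h <-.
Qed.

End Differentials.

Section Calculus.
Variables (R : realType) (m : nat).
Implicit Types (U V : set 'rV[R]_m) (f g : 'rV[R]_m -> R) (k : nat).

Lemma partial_ext U f g i x : open U -> U x -> (forall y, U y -> f y = g y) ->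
  partial i f x = partial i g x.
Proof.
move=> oU Ux fg; apply: near_eq_derive.
exact: open_near Ux fg.
Qed.

Lemma eq_partial f g i x : f =1 g -> partial i f x = partial i g x.
Proof. by move=> /funext->. Qed.

(** The rules for derivatives hold only on [U], while [partial] is a total function. Each closure
    lemma below computes the derivative on [U] and transports the class along this extensionality;
    openness of [U] makes derivatives local. *)
Lemma Ck_ext k U f g : open U -> (forall x, U x -> f x = g x) ->
  Ck k U f -> Ck k U g.
Proof.
move=> oU; elim: k f g => [|k IH] f g fg.
  move=> cf x Ux; have := cf x Ux; rewrite /prop_for /continuous_at -(fg _ Ux).
  have nfg : {near x, f =1 g} by exact: open_near Ux fg.
  by apply: cvg_trans; exact: near_eq_cvg nfg.
move=> [df pf]; split.
  move=> x Ux; apply: near_eq_differentiable (df x Ux).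
  exact: open_near Ux fg.
move=> i; apply: IH (pf i) => x Ux; exact: partial_ext oU Ux fg.
Qed.

Lemma Ck_continuous k U f x : Ck k U f -> U x -> {for x, continuous f}.
Proof.
by case: k => [|k] /= Cf Ux; [exact: Cf|exact/differentiable_continuous/Cf.1].
Qed.

Lemma CkS k U f : Ck k.+1 U f -> Ck k U f.
Proof.
elim: k f => [|k IH] f Cf.
  by move=> x Ux; exact: Ck_continuous Cf Ux.
by split; [exact: Cf.1|move=> i; exact/IH/Cf.2].
Qed.

Lemma Ck_sub k U V f : V `<=` U -> Ck k U f -> Ck k V f.
Proof.
move=> VU; elim: k f => [|k IH] f /= Cf; first by move=> x /VU/Cf.
by split; [move=> x /VU/Cf.1|move=> i; exact/IH/Cf.2].
Qed.

Lemma Ck_cst k U (a : R) : Ck k U (fun=> a).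
Proof.
elim: k a => [|k IH] a; first by move=> x _; exact: cst_continuous.
split=> [x _|i]; first exact: differentiable_cst.
rewrite (_ : partial i _ = fun=> 0); first exact: IH.
by apply/funext => x; rewrite /partial derive_cst.
Qed.

Lemma partial_coord i j x :
  partial i (fun y : 'rV[R]_m => y 0 j) x = (i == j)%:R.
Proof.
have /matrixP/(_ 0 j) := derive_mx (@derivable_id _ _ x (delta_mx 0 i)).
by rewrite /partial derive_id !mxE eqxx /= eq_sym => <-.
Qed.

Lemma Ck_coord k U j : Ck k U (fun x => x 0 j).
Proof.
case: k => [|k]; first by move=> x _; exact: coord_continuous.
split=> [x _|i]; first exact: differentiable_coord.
rewrite (_ : partial i _ = fun=> (i == j)%:R); first exact: Ck_cst.
by apply/funext => x; exact: partial_coord.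
Qed.

Lemma partialD i f g x : differentiable f x -> differentiable g x ->
  partial i (fun y => f y + g y) x = partial i f x + partial i g x.
Proof. by move=> df dg; rewrite /partial deriveD//; exact: diff_derivable. Qed.

Lemma partialM i f g x : differentiable f x -> differentiable g x ->
  partial i (fun y => f y * g y) x = f x * partial i g x + g x * partial i f x.
Proof. by move=> df dg; rewrite /partial deriveM//; exact: diff_derivable. Qed.

Lemma partialZ i (a : R) f x : differentiable f x ->
  partial i (fun y => a * f y) x = a * partial i f x.
Proof. by move=> df; rewrite /partial (deriveZ a)//; exact: diff_derivable. Qed.

Lemma partial_sum n i (F : 'I_n -> 'rV[R]_m -> R) x :
  (forall j, differentiable (F j) x) ->
  partial i (fun y => \sum_j F j y) x = \sum_j partial i (F j) x.
Proof.
move=> dF; rewrite /partial.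
rewrite (_ : (fun y => _) = \sum_j F j); last by apply/funext => y; rewrite fct_sumE.
by rewrite derive_sum// => j; exact: diff_derivable.
Qed.

Lemma CkD k U f g : open U -> Ck k U f -> Ck k U g ->
  Ck k U (fun x => f x + g x).
Proof.
move=> oU; elim: k f g => [|k IH] f g.
  by move=> cf cg x Ux; exact: continuousD (cf x Ux) (cg x Ux).
move=> [df pf] [dg pg]; split=> [x Ux|i].
  by apply: differentiableD; [exact: df|exact: dg].
apply: Ck_ext (IH _ _ (pf i) (pg i)) => // x Ux.
by rewrite partialD//; [exact: df|exact: dg].
Qed.

Lemma CkM k U f g : open U -> Ck k U f -> Ck k U g ->
  Ck k U (fun x => f x * g x).
Proof.
move=> oU; elim: k f g => [|k IH] f g.
  by move=> cf cg x Ux; exact: continuousM (cf x Ux) (cg x Ux).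
move=> Cf Cg; have [df pf] := Cf; have [dg pg] := Cg; split=> [x Ux|i].
  by apply: differentiableM; [exact: df|exact: dg].
have Cs := CkD oU (IH _ _ (CkS Cf) (pg i)) (IH _ _ (CkS Cg) (pf i)).
apply: Ck_ext Cs => // x Ux.
by rewrite partialM//; [exact: df|exact: dg].
Qed.

Lemma Ck_sum k U (I : Type) (r : seq I) (P : pred I) (F : I -> 'rV[R]_m -> R) :
  open U -> (forall i, Ck k U (F i)) -> Ck k U (fun x => \sum_(i <- r | P i) F i x).
Proof.
move=> oU CF; elim: r => [|i r IH].
  by apply: Ck_ext (Ck_cst k U 0) => // x _; rewrite big_nil.
apply: (@Ck_ext _ _ (if P i then fun x => F i x + \sum_(j <- r | P j) F j x
  else fun x => \sum_(j <- r | P j) F j x)) => //.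
  by move=> x _; rewrite big_cons; case: ifP.
by case: ifP => // _; exact: CkD.
Qed.

Lemma Ck_prod k U (I : Type) (r : seq I) (P : pred I) (F : I -> 'rV[R]_m -> R) :
  open U -> (forall i, Ck k U (F i)) -> Ck k U (fun x => \prod_(i <- r | P i) F i x).
Proof.
move=> oU CF; elim: r => [|i r IH].
  by apply: Ck_ext (Ck_cst k U 1) => // x _; rewrite big_nil.
apply: (@Ck_ext _ _ (if P i then fun x => F i x * \prod_(j <- r | P j) F j x
  else fun x => \prod_(j <- r | P j) F j x)) => //.
  by move=> x _; rewrite big_cons; case: ifP.
by case: ifP => // _; exact: CkM.
Qed.

(** The derivative [- f^-2 * partial i f] involves [f^-1] one level lower, so the induction
    closes. *)
Lemma CkV k U f : open U -> (forall x, U x -> f x != 0) -> Ck k U f ->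
  Ck k U (fun x => (f x)^-1).
Proof.
move=> oU f0; elim: k => [|k IH] Cf.
  by move=> x Ux; exact: continuousV (f0 x Ux) (Cf x Ux).
have [df pf] := Cf; split=> [x Ux|i].
  by apply: differentiableV; [exact: df|exact: f0].
have CV := IH (CkS Cf).
have Cs := CkM oU (Ck_cst k U (-1)) (CkM oU (CkM oU CV CV) (pf i)).
apply: Ck_ext Cs => // x Ux.
rewrite /partial deriveV; [|exact: f0|exact/diff_derivable/df].
by rewrite -exprVn expr2 mulN1r /GRing.scale /= mulNr.
Qed.

Lemma Ck_det k U p (F : 'rV[R]_m -> 'M[R]_p) : open U ->
  (forall i j, Ck k U (fun x => F x i j)) -> Ck k U (fun x => \det (F x)).
Proof.
move=> oU CF; apply: Ck_sum => // s; apply: CkM => //; first exact: Ck_cst.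
by apply: Ck_prod => // i; exact: CF.
Qed.

(** Cramer's rule: on [U] the entries of the inverse are cofactors divided by a determinant that
    does not vanish. *)
Lemma Ck_invmx k U p (F : 'rV[R]_m -> 'M[R]_p) : open U ->
  (forall x, U x -> F x \in unitmx) ->
  (forall i j, Ck k U (fun x => F x i j)) ->
  forall i j, Ck k U (fun x => invmx (F x) i j).
Proof.
move=> oU uF CF i j.
have C1 : Ck k U (fun x => (\det (F x))^-1 * ((-1) ^+ (j + i) *
    \det (row' j (col' i (F x))))).
  apply: CkM => //.
    apply: CkV => //; last exact: Ck_det.
    by move=> x /uF; rewrite unitmxE unitfE.
  apply: CkM => //; first exact: Ck_cst.
  apply: Ck_det => // a b.
  by under eq_fun do rewrite !mxE; exact: CF.
apply: Ck_ext C1 => // x Ux.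
by rewrite /invmx uF// !mxE.
Qed.

End Calculus.

(** * Chain rule and Jacobians of maps between spaces of rows *)

Section Composition.
Variables (R : realType) (m l : nat).
Implicit Types (U : set 'rV[R]_m) (V : set 'rV[R]_l).

Lemma differentiable_row (W : normedModType R) (g : W -> 'rV[R]_l) x :
  (forall j, differentiable (fun y => g y 0 j) x) -> differentiable g x.
Proof.
move=> dg.
rewrite (_ : g = \sum_j (fun y => g y 0 j *: delta_mx 0 j)); last first.
  by apply/funext => y; rewrite fct_sumE -row_sum_delta.
by apply: differentiable_sum => j; exact: differentiableZl.
Qed.

Lemma derive_rowE (g : 'rV[R]_m -> 'rV[R]_l) x v : differentiable g x ->
  'D_v g x = \row_j 'D_v (fun y => g y 0 j) x.
Proof.
move=> dg; rewrite derive_mx; last exact: diff_derivable.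
by apply/rowP => j; rewrite !mxE.
Qed.

Lemma derive_partial (f : 'rV[R]_l -> R) x v : differentiable f x ->
  'D_v f x = \sum_j v 0 j * partial j f x.
Proof.
move=> df; rewrite deriveE// {1}(row_sum_delta v) linear_sum.
apply: eq_bigr => j _; rewrite linearZ /partial deriveE//.
Qed.

Lemma partial_comp (f : 'rV[R]_l -> R) (g : 'rV[R]_m -> 'rV[R]_l) i x :
  differentiable f (g x) -> (forall j, differentiable (fun y => g y 0 j) x) ->
  partial i (f \o g) x =
    \sum_j partial j f (g x) * partial i (fun y => g y 0 j) x.
Proof.
move=> df /differentiable_row dg.
rewrite /partial deriveE; last exact: differentiable_comp.
rewrite diff_comp// /comp -deriveE// -deriveE// derive_partial//.
by apply: eq_bigr => j _; rewrite derive_rowE// mxE mulrC.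
Qed.

Lemma continuous_row (T : topologicalType) (g : T -> 'rV[R]_l) x :
  (forall j, {for x, continuous (fun y => g y 0 j)}) -> {for x, continuous g}.
Proof.
move=> cg; apply/cvgrPdist_le => e e0.
have cg' (j : 'I_l) : \forall y \near x, `|g x 0 j - g y 0 j| <= e.
  exact: (cvgrPdist_le _ _).1 (cg j) e e0.
have {}cg' : \forall y \near x, forall j, `|g x 0 j - g y 0 j| <= e.
  exact: filter_forall.
apply: filterS cg' => y gy.
rewrite /Num.Def.normr/= mx_normrE (bigmax_le _ (ltW e0))//= => -[i j] _.
by rewrite !mxE /= ord1; exact: gy.
Qed.

(** Induction on [k] with [f] generalized and [g] fixed: the chain rule leaves the functions
    [partial j f \o g], one level lower, times derivatives of [g]. *)
Lemma Ck_comp k U V (f : 'rV[R]_l -> R) (g : 'rV[R]_m -> 'rV[R]_l) :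
  open U -> (forall x, U x -> V (g x)) ->
  Ck k V f -> (forall j, Ck k U (fun x => g x 0 j)) -> Ck k U (f \o g).
Proof.
move=> oU gU; elim: k f => [|k IH] f Cf Cg.
  move=> x Ux; apply: continuous_comp; last exact/Cf/gU.
  by apply: continuous_row => j; exact: Cg.
have [df pf] := Cf; split=> [x Ux|i].
  apply: differentiable_comp; last exact/df/gU.
  by apply: differentiable_row => j; exact: (Cg j).1.
have Cs : Ck k U (fun x => \sum_j (partial j f \o g) x *
    partial i (fun y => g y 0 j) x).
  apply: Ck_sum => // j; apply: CkM => //; last exact: (Cg j).2.
  by apply: (IH _ (pf j)) => j'; exact/CkS/Cg.
apply: Ck_ext Cs => // x Ux; rewrite partial_comp//; first exact/df/gU.
by move=> j; exact: (Cg j).1.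
Qed.

Lemma jacE (f : 'rV[R]_m -> 'rV[R]_l) x :
  (forall j, differentiable (fun y => f y 0 j) x) ->
  jac f x = \matrix_(i, j) partial j (fun y => f y 0 i) x.
Proof.
move=> /differentiable_row df; apply/matrixP => i j.
have := deriveEjacobian (delta_mx 0 j) df.
rewrite -rowE derive_rowE// => /rowP/(_ i) E0.
have E : partial j (fun y => f y 0 i) x = jacobian f x j i.
  by move: E0; rewrite mxE [X in _ = X -> _]mxE.
by rewrite /jac [LHS]mxE [RHS]mxE E.
Qed.

End Composition.

(** * Mean value and symmetry of second derivatives *)

Section MeanValue.
Variables (R : realType) (m : nat).
Implicit Types (U : set 'rV[R]_m) (f : 'rV[R]_m -> R).

Lemma norm_row_le (v : 'rV[R]_m) (e : R) : 0 <= e ->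
  (forall j, `|v 0 j| <= e) -> `|v| <= e.
Proof.
move=> e0 ve; rewrite /Num.Def.normr/= mx_normrE.
by apply: bigmax_le => // -[i j] _ /=; rewrite ord1.
Qed.

Lemma norm_coord (v : 'rV[R]_m) j : `|v 0 j| <= `|v|.
Proof.
rewrite {2}/Num.Def.normr/= mx_normrE.
exact: (le_bigmax _ (fun ij : 'I_1 * 'I_m => `|v ij.1 ij.2|) (0, j)).
Qed.

Lemma norm_delta_le1 (i : 'I_m) : `|delta_mx 0 i : 'rV[R]_m| <= 1.
Proof.
apply: norm_row_le => // j; rewrite mxE.
by case: andP => _; rewrite ?normr1 ?normr0.
Qed.

(** Both difference quotients are the same function of [h], so derivability and value transfer at
    once. *)
Lemma derive_line f x v t : differentiable f (x + t *: v) ->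
  is_derive t 1 (fun s : R => f (x + s *: v)) ('D_v f (x + t *: v)).
Proof.
move=> dfx; have df : derivable f (x + t *: v) v by exact: diff_derivable.
pose g (s : R) := f (x + s *: v).
have E : (fun h : R => h^-1 *: ((g \o shift t) (h *: 1) - g t)) =
    (fun h => h^-1 *: ((f \o shift (x + t *: v)) (h *: v) - f (x + t *: v))).
  by apply/funext => h; rewrite /g /= scalerDl addrCA [h *: 1]mulr1.
split; last by rewrite /derive E.
by rewrite /derivable E.
Qed.

Lemma derive_shift_arg f x c v :
  'D_v (fun y => f (y + c)) x = 'D_v f (x + c).
Proof.
rewrite /derive (_ : (fun h => _) =
  (fun h => h^-1 *: ((f \o shift (x + c)) (h *: v) - f (x + c))))//.
by apply/funext => h /=; rewrite addrA.
Qed.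

Lemma mean_value f x v :
  (forall t, 0 <= t <= 1 -> differentiable f (x + t *: v)) ->
  exists2 t, 0 <= t <= 1 & f (x + v) - f x = 'D_v f (x + t *: v).
Proof.
move=> df; have dl t t01 := derive_line (df t t01).
have [||t] := @MVT_segment R (fun s => f (x + s *: v))
  (fun s => 'D_v f (x + s *: v)) 0 1 ler01.
- by move=> t /[!in_itv]/= /andP[/ltW t0 /ltW t1]; apply: dl; rewrite t0.
- apply: derivable_within_continuous => t; rewrite in_itv /= => t01.
  by have [] := dl t t01.
rewrite in_itv /= => t01; rewrite subr0 mulr1 scale1r scale0r addr0 => E.
by exists t.
Qed.

Lemma ball_segment (a x v : 'rV[R]_m) r t : 0 <= t <= 1 ->
  ball a r x -> ball a r (x + v) -> ball a r (x + t *: v).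
Proof.
move=> /andP[t0 t1]; rewrite -ball_normE /= => xr yr.
have -> : a - (x + t *: v) = (1 - t) *: (a - x) + t *: (a - (x + v)).
  rewrite !scalerBl !scalerBr !scale1r scalerDr.
  by rewrite [RHS]addrC addrA opprD; apply/rowP => j; rewrite !mxE; ring.
apply: le_lt_trans (ler_normD _ _) _; rewrite !normrZ !ger0_norm ?subr_ge0//.
(* The strict inequality is taken from the endpoint [x + v], whose weight [t] must then be positive;
   for [t = 0] the point is [x] itself. *)
have [->|tn0] := eqVneq t 0; first by rewrite subr0 mul1r mul0r addr0.
have tp : 0 < t by rewrite lt_neqAle eq_sym tn0.
have : t * `|a - (x + v)| < t * r by rewrite ltr_pM2l.
have : (1 - t) * `|a - x| <= (1 - t) * r.
  by rewrite ler_wpM2l ?subr_ge0 // ltW.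
by lra.
Qed.

(* The left-hand side is symmetric in [i] and [j] up to the order of the
   summands, so the two mixed derivatives agree at two points near [x]. *)
Lemma second_difference f U i j x h : Ck 2 U f -> 0 <= h ->
  (forall s t, 0 <= s <= h -> 0 <= t <= h ->
     U (x + s *: delta_mx 0 i + t *: delta_mx 0 j)) ->
  exists s t, [/\ 0 <= s <= h, 0 <= t <= h &
    f (x + h *: delta_mx 0 i + h *: delta_mx 0 j) - f (x + h *: delta_mx 0 i)
      - (f (x + h *: delta_mx 0 j) - f x)
    = h ^+ 2 * partial j (partial i f) (x + s *: delta_mx 0 i + t *: delta_mx 0 j)].
Proof.
move=> [df /(_ i)[dpf _]] h0 Uh.
set ei := delta_mx 0 i; set ej := delta_mx 0 j.
have sh s : 0 <= s <= 1 -> 0 <= s * h <= h.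
  by move=> /andP[s0 s1]; rewrite mulr_ge0//= ler_piMl.
have Ui s : 0 <= s <= 1 -> U (x + s *: (h *: ei)).
  move=> /sh s01; have := Uh (s * h) 0 s01; rewrite lexx h0 scale0r addr0 scalerA.
  exact.
have Uij s t : 0 <= s <= 1 -> 0 <= t <= 1 ->
    U (x + s *: (h *: ei) + t *: (h *: ej)).
  by move=> /sh s01 /sh t01; rewrite !scalerA; exact: Uh.
(* Taking the increment in direction [j] as a function, the mean value theorem in direction [i]
   yields [partial i f] at two points that differ by [h *: ej]; a second application, in direction
   [j], finishes. *)
pose phi := (fun y => f (y + h *: ej)) - f.
have dshift s : 0 <= s <= 1 ->
    differentiable (fun y => f (y + h *: ej)) (x + s *: (h *: ei)).
  move=> s01; apply: (@differentiable_comp _ _ _ _ (fun y => y + h *: ej) f).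
    exact: differentiableD.
  by apply: df; have := Uij s 1 s01; rewrite lexx ler01 scale1r; exact.
have [|s s01] := @mean_value phi x (h *: ei) _.
  move=> s s01; apply: differentiableB; first exact: dshift.
  exact/df/Ui.
rewrite /phi deriveB; last 2 first.
- exact/diff_derivable/dshift.
- exact/diff_derivable/df/Ui.
rewrite derive_shift_arg.
have Dh y : U y -> 'D_(h *: ei) f y = h * partial i f y.
  by move=> Uy; rewrite deriveE ?linearZ /partial ?deriveE //; exact: df.
rewrite Dh; last first.
  by have := Uij s 1 s01; rewrite lexx ler01 scale1r; exact.
rewrite Dh; last exact: Ui.
have [|t t01] := @mean_value (partial i f) (x + s *: (h *: ei)) (h *: ej) _.
  by move=> t t01; apply/dpf/Uij.
rewrite -mulrBr => -> E.
exists (s * h), (t * h); split; [exact: sh|exact: sh|].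
move: E => /= ->.
rewrite deriveE; last exact/dpf/Uij.
rewrite linearZ /= -deriveE; last exact/dpf/Uij.
by rewrite !scalerA mulrA expr2.
Qed.

(** Schwarz's theorem: continuity of both mixed derivatives at [x] carries their agreement at two
    nearby points over to [x], up to any [e]. *)
Lemma partialC f U i j x : open U -> U x -> Ck 2 U f ->
  partial i (partial j f) x = partial j (partial i f) x.
Proof.
move=> oU Ux Cf.
apply/eqP; rewrite -subr_eq0 -normr_le0; apply/ler_addgt0Pr => e e0.
rewrite add0r.
have tri (u v z : R) : `|u - z| <= e / 2 -> `|v - z| <= e / 2 -> `|u - v| <= e.
  move=> uz vz; rewrite -(subrKA z) [leRHS]splitr.
  by apply: le_trans (ler_normD _ _) _; apply: lerD => //; rewrite distrC.
have e2 : 0 < e / 2 by rewrite divr_gt0.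
have cont a b : \forall y \near x,
    `|partial a (partial b f) x - partial a (partial b f) y| <= e / 2.
  have := (Cf.2 b).2 a x Ux.
  by move/cvgrPdist_le; exact.
have : \forall y \near x, [/\ U y,
    `|partial i (partial j f) x - partial i (partial j f) y| <= e / 2 &
    `|partial j (partial i f) x - partial j (partial i f) y| <= e / 2].
  have nU : \forall y \near x, U y by exact: open_nbhs_nbhs.
  apply: filterS (filterI nU (filterI (cont i j) (cont j i))).
  by move=> y [? []].
move/nbhs_ballP => [d /= d0 bd].
(* Points of the square of side [h] lie within [2 h = d / 2] of [x], hence strictly inside the
   ball. *)
pose h := d / 4.
have h0 : 0 < h by rewrite divr_gt0.
have near_x a b s t : 0 <= s <= h -> 0 <= t <= h ->
    ball x d (x + s *: delta_mx 0 a + t *: delta_mx 0 b).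
  move=> /andP[s0 sh] /andP[t0 th]; rewrite -ball_normE /= -addrA opprD addNKr.
  rewrite normrN; apply: le_lt_trans (ler_normD _ _) _.
  rewrite !normrZ !ger0_norm//.
  have : s * `|delta_mx 0 a : 'rV[R]_m| <= s * 1.
    by rewrite ler_wpM2l// norm_delta_le1.
  have : t * `|delta_mx 0 b : 'rV[R]_m| <= t * 1.
    by rewrite ler_wpM2l// norm_delta_le1.
  rewrite /h in sh th; lra.
have Unear a b s t : 0 <= s <= h -> 0 <= t <= h ->
    U (x + s *: delta_mx 0 a + t *: delta_mx 0 b).
  by move=> sh th; have [] := bd _ (near_x a b _ _ sh th).
have [s [t [sh th E1]]] := second_difference Cf (ltW h0) (Unear i j).
have [s' [t' [sh' th' E2]]] := second_difference Cf (ltW h0) (Unear j i).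
have [_ _ B1] := bd _ (near_x i j _ _ sh th).
have [_ B2 _] := bd _ (near_x j i _ _ sh' th').
have h2 : h ^+ 2 != 0 by rewrite expf_neq0 // gt_eqF.
have : h ^+ 2 * partial j (partial i f) (x + s *: delta_mx 0 i + t *: delta_mx 0 j)
  = h ^+ 2 * partial i (partial j f) (x + s' *: delta_mx 0 j + t' *: delta_mx 0 i).
  apply: etrans (esym E1) (etrans _ E2); rewrite [x + _ + _]addrAC.
  move: (f _) (f _) (f _) (f _) => f1 f2 f3 f4; ring.
move/(mulfI h2) => E; rewrite E in B1.
exact: tri B2 B1.
Qed.

End MeanValue.

(** * Inverse function theorem *)

(** Makes rows a complete normed module, as the Banach fixed point theorem requires. *)
HB.instance Definition _ (R : realType) n := Complete.on (matrix R 1 n).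

Section Contraction.
Variables (R : realType) (n : nat).
Implicit Types (x y v : 'rV[R]_n) (A : 'M[R]_n).

Lemma norm_mulmx_le A : exists2 C : R, 0 < C & forall v, `|v *m A| <= C * `|v|.
Proof.
pose C := \sum_k \sum_j `|A k j|.
have C0 : 0 <= C by apply: sumr_ge0 => k _; apply: sumr_ge0.
(* The summand 1 keeps the constant positive even for [A = 0]; it serves as a divisor later. *)
exists (1 + C) => [|v]; first by rewrite ltr_pwDl.
apply: norm_row_le => [|j]; first by rewrite mulr_ge0// addr_ge0.
rewrite mxE; apply: le_trans (ler_norm_sum _ _ _) _.
apply: (@le_trans _ _ (C * `|v|)); last by rewrite ler_wpM2r// lerDr.
rewrite mulr_suml; apply: ler_sum => k _; rewrite normrM mulrC.
apply: ler_pM => //; last exact: norm_coord.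
by rewrite (bigD1 j)//= lerDl sumr_ge0.
Qed.

Lemma mulmxr_continuous A : continuous (mulmxr A : 'rV[R]_n -> 'rV[R]_n).
Proof.
apply/linear_bounded_continuous/ex_bound.
have [C C0 AC] := norm_mulmx_le A; exists C.
apply/nbhs_ballP; exists 1 => //= v; rewrite -ball_normE /= sub0r normrN => v1.
apply: le_trans (AC v) _; rewrite -[leRHS]mulr1 ler_wpM2l ?(ltW C0)//.
exact: ltW.
Qed.

Lemma contraction_fixed_point (B : set 'rV[R]_n) (f : 'rV[R]_n -> 'rV[R]_n) (q : R) :
  0 <= q < 1 -> (forall x, B x -> B (f x)) ->
  (forall x y, B x -> B y -> `|f x - f y| <= q * `|x - y|) ->
  closed B -> B !=set0 -> exists2 x, B x & x = f x.
Proof.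
move=> /andP[q0 q1] fB fq cB B0.
pose F : {fun B >-> B} := mkfun_fun fB.
apply: (@banach_fixed_point R 'rV[R]_n B F) => //.
exists (NngNum q0); split => //= -[x y] /= [Bx By]; exact: fq.
Qed.

(** The mean value theorem is applied to each component, with its own intermediate point; each of
    the [n] partial derivatives contributes at most [e * |x - y|], hence the factor [n] in the sup
    norm. *)
Lemma lipschitz_ball (H : 'rV[R]_n -> 'rV[R]_n) a r (e : R) : 0 <= e ->
  (forall x i, ball a r x -> differentiable (fun y => H y 0 i) x) ->
  (forall x i j, ball a r x -> `|partial j (fun y => H y 0 i) x| <= e) ->
  forall x y, ball a r x -> ball a r y -> `|H x - H y| <= n%:R * e * `|x - y|.
Proof.
move=> e0 dH He x y Bx By.
apply: norm_row_le => [|i]; first by rewrite !mulr_ge0.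
have By' : ball a r (y + (x - y)) by rewrite addrC subrK.
have [|t t01] := @mean_value _ _ (fun z => H z 0 i) y (x - y) _.
  by move=> t t01; apply: dH; exact: ball_segment.
rewrite subrKC => E; rewrite !mxE E derive_partial; last first.
  by apply: dH; exact: ball_segment.
apply: le_trans (ler_norm_sum _ _ _) _.
rewrite -mulrA -[X in X%:R * _]card_ord mulr_natl -sumr_const.
apply: ler_sum => j _; rewrite normrM mulrC.
apply: ler_pM => //; last exact: norm_coord.
by apply: He; exact: ball_segment.
Qed.

(* Solve [f x = y] by iterating [x |-> x + (y - f x) L]. *)
Lemma near_identity_open (N : set 'rV[R]_n) (f : 'rV[R]_n -> 'rV[R]_n) L :
  open N -> L \in unitmx ->
  (forall x y, N x -> N y ->
     `|(x - f x *m L) - (y - f y *m L)| <= 2^-1 * `|x - y|) ->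
  open (f @` N).
Proof.
move=> oN uL fc; rewrite openE => _ [x0 Nx0 <-].
have /nbhs_ballP[d /= d0 dN] : nbhs x0 N by exact: open_nbhs_nbhs.
pose s := d / 2; have s0 : 0 < s by rewrite divr_gt0.
have BN : closed_ball x0 s `<=` N.
  move=> x; rewrite closed_ballE// /closed_ball_ /= => xs; apply: dN.
  by rewrite -ball_normE /=; apply: le_lt_trans xs _; rewrite /s; lra.
have [C C0 LC] := norm_mulmx_le L.
(* For [y] this close to [f x0], the first iterate moves [x0] by at most [s / 2]; the contraction
   adds at most [s / 2], so [phi] preserves the closed ball of radius [s]. *)
apply/nbhs_ballP; exists (s / 2 / C) => /=; first by rewrite !divr_gt0.
move=> y; rewrite -ball_normE /= => fy.
pose phi x := x + (y - f x) *m L.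
have phiE x : phi x = (x - f x *m L) + y *m L.
  by rewrite /phi mulmxBl addrCA addrC addrAC.
have phiq x x' : N x -> N x' -> `|phi x - phi x'| <= 2^-1 * `|x - x'|.
  move=> Nx Nx'; rewrite !phiE opprD addrACA subrr addr0; exact: fc.
have [|||||x Bx] := @contraction_fixed_point (closed_ball x0 s) phi 2^-1.
- by rewrite invr_ge0 ler0n invf_lt1// ltr1n.
- move=> x Bx; have := Bx; rewrite closed_ballE// /closed_ball_ /= => xs.
  rewrite -(subrKA (phi x0)); apply: le_trans (ler_normD _ _) _.
  have : `|phi x0 - phi x| <= 2^-1 * `|x0 - x| by apply: phiq => //; exact: BN.
  have : `|x0 - phi x0| <= s / 2.
    rewrite /phi opprD addNKr normrN; apply: le_trans (LC _) _.
    by rewrite -ler_pdivlMl// mulrC distrC ltW.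
  lra.
- by move=> x x' /BN Nx /BN Nx'; exact: phiq.
- exact: closed_ball_closed.
- by exists x0; exact: closed_ballxx.
move=> E; exists x; first exact: BN.
have : (y - f x) *m L = 0.
  by apply: (addrI x); rewrite addr0 [RHS]E.
by move/(canRL (mulmxK uL)); rewrite mul0mx => /subr0_eq.
Qed.

(** The Lipschitz bound on the displacement [h = S (k + f x0) - x0] turns the remainder [o(h)] of
    [f] into [o(k)]; up to sign, the remainder of [S] is its image under the inverse matrix. *)
Lemma inverse_differentiable (f S : 'rV[R]_n -> 'rV[R]_n) x0 (C : R) : 0 < C ->
  differentiable f x0 -> jac f x0 \in unitmx ->
  S (f x0) = x0 ->
  (\forall y \near f x0, f (S y) = y /\ `|S y - x0| <= C * `|y - f x0|) ->
  is_diff (f x0) S (mulmxr (invmx (jac f x0))^T).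
Proof.
move=> C0 df uJ Sx0 nS; set M := (invmx _)^T.
have [D D0 MD] := norm_mulmx_le M.
apply: is_diff_littleo => [|e e0]; first exact: mulmxr_continuous.
have [_ E] := (diff_locallyP _ _).1 df.
(* [D] bounds the inverse matrix and [C] the displacement, so the product of the three bounds is
   [e * |k|]. *)
have e1 : 0 < e / (D * C) by rewrite divr_gt0// mulr_gt0.
have /eqaddoP/(_ _ e1)/nbhs_ballP[d /= d0 fd] := E.
have {}nS : \forall k \near (0 : 'rV[R]_n), f (S (k + f x0)) = k + f x0 /\
    `|S (k + f x0) - x0| <= C * `|k|.
  move: nS; rewrite (near_shift 0) subr0; apply: filterS => k /=.
  by rewrite addrK.
have nb : \forall k \near (0 : 'rV[R]_n), `|k| < d / C.
  apply/nbhs_ballP; exists (d / C) => /=; first by rewrite divr_gt0.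
  by move=> k; rewrite -ball_normE /= sub0r normrN.
apply: filterS2 nS nb => k [fS SC] kd; rewrite Sx0 /=.
set h := S (k + f x0) - x0 in SC *.
have hd : ball 0 d h.
  rewrite -ball_normE /= sub0r normrN; apply: le_lt_trans SC _.
  by rewrite mulrC -ltr_pdivlMr.
have := fd h hd; rewrite !fctE /= -(deriveE _ df) deriveEjacobian//.
rewrite /h subrK fS -/h => B.
have -> : S (k + f x0) - (x0 + k *m M) =
      - ((k + f x0 - (f x0 + h *m jacobian f x0)) *m M).
  have -> : k + f x0 - (f x0 + h *m jacobian f x0) = k - h *m jacobian f x0.
    by rewrite [k + _]addrC opprD addrACA subrr add0r.
  rewrite mulmxBl.
  have uJ' : jacobian f x0 \in unitmx by rewrite -unitmx_tr.
  have -> : M = invmx (jacobian f x0) by rewrite /M /jac trmx_inv trmxK.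
  by rewrite mulmxK// opprB /h opprD addrA.
rewrite normrN; apply: le_trans (MD _) _.
rewrite -ler_pdivlMl//; apply: le_trans B _.
apply: (@le_trans _ _ (e / (D * C) * (C * `|k|))).
  by rewrite ler_wpM2l// ltW.
rewrite le_eqVlt; apply/orP; left; apply/eqP; move: `|k| => u.
by field; rewrite !gt_eqF.
Qed.

(** Composing [f] with the inverse of its derivative at [a] gives a map whose difference [H] from
    the identity has zero derivative at [a], hence is a 1/2-contraction on a small ball [N]. This
    yields both an open image and injectivity with a Lipschitz inverse. *)
Theorem inverse_function (U : set 'rV[R]_n) (f : 'rV[R]_n -> 'rV[R]_n) a :
  open U -> U a -> smooth_mx U f -> jac f a \in unitmx ->
  exists (N : set 'rV[R]_n) (S : 'rV[R]_n -> 'rV[R]_n),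
    [/\ open N /\ N a, N `<=` U, open (f @` N),
        (forall x, N x -> S (f x) = x /\ jac f x \in unitmx)
      & smooth_mx (f @` N) S].
Proof.
move=> oU Ua sf uJ.
have df x j : U x -> differentiable (fun y => f y 0 j) x.
  by move=> Ux; have [dfx _] := sf 0 j 1; exact: dfx.
have dfr x : U x -> differentiable f x.
  by move=> Ux; apply: differentiable_row => j; exact: df.
pose L := (invmx (jac f a))^T; pose H x := x - f x *m L.
have uL : L \in unitmx by rewrite unitmx_tr unitmx_inv.
have HE x i : H x 0 i = x 0 i + -1 * \sum_k L k i * f x 0 k.
  by rewrite /H !mxE mulN1r; under eq_bigr do rewrite mulrC.
have CH k i : Ck k U (fun x => H x 0 i).
  under eq_fun do rewrite HE.
  apply: CkD => //; first exact: Ck_coord.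
  apply: CkM => //; first exact: Ck_cst.
  apply: Ck_sum => // j; apply: CkM => //; first exact: Ck_cst.
  exact: sf.
have dH x i : U x -> differentiable (fun y => H y 0 i) x.
  by move=> Ux; have [dHx _] := CH 1 i; exact: dHx.
pose G x : 'M[R]_n := \matrix_(i, j) partial j (fun y => f y 0 i) x.
have GE x : U x -> jac f x = G x by move=> Ux; apply: jacE => j; exact: df.
have H0 i j : partial j (fun y => H y 0 i) a = 0.
  under eq_fun do rewrite HE.
  have dL k : differentiable (fun y => L k i * f y 0 k) a.
    by apply: differentiableM; [exact: differentiable_cst|exact: df].
  have dsum : differentiable (fun y => \sum_k L k i * f y 0 k) a.
    rewrite (_ : (fun y => _) = \sum_k (fun y => L k i * f y 0 k)).
      exact: differentiable_sum.
    by apply/funext => y; rewrite fct_sumE.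
  rewrite partialD; [|exact: differentiable_coord|]; last first.
    by apply: differentiableM; [exact: differentiable_cst|exact: dsum].
  rewrite partial_coord partialZ// partial_sum//.
  rewrite (eq_bigr _ (fun k _ => partialZ j (L k i) (df a k Ua))).
  have /matrixP/(_ i j) := mulVmx uJ; rewrite GE// !mxE eq_sym => <-.
  rewrite mulN1r; apply/eqP; rewrite subr_eq0; apply/eqP; apply: eq_bigr => k _.
  by rewrite /L GE// !mxE.
(* The successor keeps [e] positive when [n = 0], and [n e <= 1/2] still holds. *)
pose e : R := (2 * n.+1%:R)^-1.
have e0 : 0 < e by rewrite invr_gt0 mulr_gt0.
have ne : n%:R * e <= 2^-1.
  rewrite /e invfM mulrCA ler_piMr ?invr_ge0// ler_pdivrMr// mul1r ler_nat.
  exact: leqnSn.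
have CG k i j : Ck k U (fun x => G x i j).
  under eq_fun do rewrite mxE.
  by have [_] := sf 0 i k.+1; exact.
have nU : \forall x \near a, U x by exact: open_nbhs_nbhs.
have nG : \forall x \near a, \det (G x) != 0.
  have dG0 : \det (G a) != 0 by rewrite -GE// -unitfE -unitmxE.
  have cdet := Ck_continuous (Ck_det oU (CG 0)) Ua.
  exact: cvgr_neq0 cdet dG0.
have nH : \forall x \near a, forall i j, `|partial j (fun y => H y 0 i) x| <= e.
  suff nHij i j : \forall x \near a, `|partial j (fun y => H y 0 i) x| <= e.
    have nHi i' : \forall x \near a,
        forall j', `|partial j' (fun y => H y 0 i') x| <= e.
      exact: (@filter_forall _ _ _ _ (nbhs_filter a) (nHij i')).
    exact: (@filter_forall _ _ _ _ (nbhs_filter a) nHi).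
  have cp : {for a, continuous (partial j (fun y => H y 0 i))}.
    by have [_ /(_ j)] := CH 1 i; exact.
  have {cp} : \forall x \near a, `|partial j (fun y => H y 0 i) a
      - partial j (fun y => H y 0 i) x| <= e.
    exact: (cvgrPdist_le _ _).1 cp e e0.
  by rewrite H0; apply: filterS => x; rewrite sub0r normrN.
have : \forall x \near a, [/\ U x, \det (G x) != 0 &
    forall i j, `|partial j (fun y => H y 0 i) x| <= e].
  by apply: filterS3 nU nG nH => x.
move/nbhs_ballP => [r /= r0 Br].
pose N : set 'rV[R]_n := ball a r.
have NU x : N x -> U x by move=> /Br[].
have oN : open N by exact: ball_open.
have Hc x y : N x -> N y -> `|H x - H y| <= 2^-1 * `|x - y|.
  move=> Nx Ny; apply: le_trans (_ : _ <= n%:R * e * `|x - y|) _.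
    apply: (@lipschitz_ball H a r e (ltW e0)) => //.
      by move=> z i /NU; exact: dH.
    by move=> z i j /Br[].
  by rewrite ler_wpM2r.
have [C C0 LC] := norm_mulmx_le L.
(* From [|x - y| <= |H x - H y| + |(f x - f y) L| <= |x - y| / 2 + C |f x - f y|]. *)
have Nlip x y : N x -> N y -> `|x - y| <= 2 * C * `|f x - f y|.
  move=> Nx Ny; have := Hc x y Nx Ny.
  have -> : H x - H y = (x - y) - (f x - f y) *m L.
    by rewrite mulmxBl /H !opprB addrACA [RHS]addrACA [- y + _]addrC.
  have := ler_normD ((x - y) - (f x - f y) *m L) ((f x - f y) *m L).
  rewrite subrK; have := LC (f x - f y).
  lra.
have inj x y : N x -> N y -> f x = f y -> x = y.
  move=> Nx Ny fxy; have := Nlip x y Nx Ny.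
  by rewrite fxy subrr normr0 mulr0 normr_le0 subr_eq0 => /eqP.
have uN x : N x -> jac f x \in unitmx.
  by move=> Nx; rewrite GE ?unitmxE ?unitfE; [have [] := Br x Nx|exact: NU].
pose S y := xget a [set x | N x /\ f x = y].
have SP y : (f @` N) y -> N (S y) /\ f (S y) = y.
  by move=> [x Nx fx]; apply: (@xgetPex _ a [set x | N x /\ f x = y]); exists x.
have Sf x : N x -> S (f x) = x.
  move=> Nx; have fN : (f @` N) (f x) by exists x.
  by have [NS fS] := SP _ fN; exact: inj.
have ofN : open (f @` N) by exact: near_identity_open uL Hc.
have dS y : (f @` N) y -> is_diff y S (mulmxr (invmx (jac f (S y)))^T).
  move=> fNy; have [NS fS] := SP _ fNy; rewrite -[X in is_diff X]fS.
  apply: (@inverse_differentiable _ _ _ (2 * C)).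
  - by rewrite mulr_gt0.
  - exact/dfr/NU.
  - exact: uN.
  - by rewrite fS.
  rewrite fS; apply: (open_near ofN fNy) => z /SP[NSz fSz]; split => //.
  by have := Nlip _ _ NSz NS; rewrite fSz fS.
exists N, S; split.
- by split; [exact: oN|exact: ballxx].
- exact: NU.
- exact: ofN.
- by move=> x Nx; split; [exact: Sf|exact: uN].
have dSr y : (f @` N) y -> differentiable S y by move=> /dS[].
(* Bootstrap: the derivative of [S] is the inverse Jacobian of [f] composed with [S], so [S] of
   class [k] has derivatives of class [k]. *)
have CS k j : Ck k (f @` N) (fun y => S y 0 j).
  elim: k j => [|k IH] j.
    move=> y fNy.
    apply: (@continuous_comp _ _ _ S (fun v : 'rV[R]_n => v 0 j)).
      exact/differentiable_continuous/dSr.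
    exact: coord_continuous.
  split=> [y fNy|i].
    apply: (@differentiable_comp _ _ _ _ S (fun v => v 0 j)); first exact: dSr.
    exact: differentiable_coord.
  have Cinv : Ck k N (fun x => invmx (G x) j i).
    apply: Ck_invmx => // [x Nx|i' j']; first by rewrite -GE; [exact: uN|exact: NU].
    exact: Ck_sub NU (CG k i' j').
  have NS y : (f @` N) y -> N (S y) by move=> /SP[].
  have := Ck_comp ofN NS Cinv IH.
  apply: Ck_ext => // y fNy /=.
  have -> : partial i (fun y => S y 0 j) y = ('D_(delta_mx 0 i) S y) 0 j.
    by rewrite derive_rowE ?mxE//; exact: dSr.
  rewrite deriveE; last exact: dSr.
  have [_ ->] := dS y fNy; rewrite /= -rowE mxE [RHS]mxE -GE//.
  exact/NU/NS.
by move=> i j k; rewrite ord1; exact: CS.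
Qed.

End Contraction.

(** * Block matrices *)

Section LiftBlocks.
Variables (R : realType) (n : nat).
Implicit Types (A B C D G H N S T : 'M[R]_n).

Definition sympl_mx : 'M[R]_(n + n) := block_mx 0 1%:M (- 1%:M) 0.

(** As [Omega] is skew, compatibility says that [Omega K], with blocks [-C, -D, A, B], is
    skew-symmetric; the relations are read off block by block. *)
Lemma compatible_blocks (K : 'M[R]_(n + n)) :
  sympl_mx^T *m K = K^T *m sympl_mx^T ->
  [/\ drsubmx K = (ulsubmx K)^T, (ursubmx K)^T = - ursubmx K
    & (dlsubmx K)^T = - dlsubmx K].
Proof.
rewrite -{1 2}[K]submxK /sympl_mx !tr_block_mx !mulmx_block.
have tN : (- 1%:M : 'M[R]_n)^T = - 1%:M by rewrite linearN /= trmx1.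
rewrite tN !trmx0 !trmx1 !mul0mx !mulmx0 !mulNmx !mulmxN !mul1mx !mulmx1.
rewrite !add0r !addr0 => /eq_block_mx[E1 E2 E3 E4]; split.
- by apply: oppr_inj.
- by apply: oppr_inj; rewrite opprK -E4.
- by rewrite -E1.
Qed.

(** With [B = 0] the matrix is block triangular, and its diagonal blocks are transposes of each
    other. *)
Lemma det_lift A C (l : R) :
  \det (block_mx A 0 C A^T - l%:M) = \det (A - l%:M) ^+ 2.
Proof.
rewrite scalar_mx_block opp_block_mx add_block_mx !subr0 det_lblock.
have -> : A^T - l%:M = (A - l%:M)^T by rewrite linearB /= tr_scalar_mx.
by rewrite det_tr expr2.
Qed.

Lemma char_poly_lift A C :
  char_poly (block_mx A 0 C A^T) = char_poly A ^+ 2.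
Proof.
rewrite /char_poly /char_poly_mx map_block_mx scalar_mx_block opp_block_mx.
rewrite add_block_mx map_mx0 !subr0 sub0r det_lblock -map_trmx.
have -> : 'X%:M - (map_mx polyC A)^T = ('X%:M - map_mx polyC A)^T.
  by rewrite linearB /= tr_scalar_mx.
by rewrite det_tr expr2.
Qed.

Lemma eigenvalue_lift A C (l : R) :
  eigenvalue (block_mx A 0 C A^T) l = eigenvalue A l.
Proof.
rewrite !eigenvalue_root_char char_poly_lift !rootE horner_exp.
by rewrite expf_eq0.
Qed.

(** A row supported on the positions meets only the upper blocks [A] and [0]. *)
Lemma left_eigenvector_lift A C (l : R) (s : 'rV[R]_n) :
  left_eigenvector A l s -> left_eigenvector (block_mx A 0 C A^T) l (row_mx s 0).
Proof.
move=> [s0 sA]; split.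
  by apply: contra_neq s0; rewrite -row_mx0 => /eq_row_mx[].
by rewrite mul_row_block !mul0mx mulmx0 !addr0 sA scale_row_mx scaler0.
Qed.

Lemma left_eigenvector_tr (m : nat) (L : 'M[R]_m) (l : R) (s : 'rV[R]_m) :
  left_eigenvector L l s ->
  right_eigenvector L^T l s^T /\ characteristic_covector L l s^T.
Proof.
move=> [s0 sL]; have E : L^T *m s^T = l *: s^T by rewrite -trmx_mul sL linearZ.
split; first by split; [rewrite trmx_eq0|].
by rewrite /characteristic_covector mulmxBl E mul_scalar_mx subrr.
Qed.

(** Here [K] is the operator in the new chart, [T] is to be [diag Q], and the last hypothesis is the
    tensor law. With [S = G^T N], the lower left block changes by a congruence and an inhomogeneous
    term: [G^T (dlsubmx K) G = C - (A^T S - S A)]. The lower right block is taken from compatibility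
    in the new chart. *)
Lemma lift_transport A C G N H T (K : 'M[R]_(n + n)) :
  G \in unitmx -> G^T *m H = 1%:M -> G *m A = T *m G -> T^T = T ->
  sympl_mx^T *m K = K^T *m sympl_mx^T ->
  K *m block_mx G 0 N H = block_mx G 0 N H *m block_mx A 0 C A^T ->
  [/\ K = block_mx T 0 (dlsubmx K) T, (dlsubmx K)^T = - dlsubmx K
    & dlsubmx K = 0 <-> C = A^T *m (G^T *m N) - (G^T *m N) *m A].
Proof.
move=> uG GH GA Tt /compatible_blocks[Kdr _ Kdl].
have uH : H \in unitmx by have [] := mulmx1_unit GH.
rewrite -{1}[K]submxK !mulmx_block !mulmx0 !mul0mx !addr0 !add0r.
move=> /eq_block_mx[E1 E2 E3 _].
have Kur : ursubmx K = 0 by apply: (can_inj (mulmxK uH)); rewrite E2 mul0mx.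
have Kul : ulsubmx K = T.
  by apply: (can_inj (mulmxK uG)); rewrite -GA -E1 Kur mul0mx addr0.
have Kdr' : drsubmx K = T by rewrite Kdr Kul.
split => //; first by rewrite -{1}[K]submxK Kul Kur Kdr'.
have uGt : G^T \in unitmx by rewrite unitmx_tr.
have E : A^T *m (G^T *m N) = G^T *m (T *m N).
  by rewrite !mulmxA -trmx_mul GA trmx_mul Tt.
have E' : G^T *m (dlsubmx K *m G) + A^T *m (G^T *m N) = (G^T *m N) *m A + C.
  by rewrite E -mulmxDr -Kdr' E3 mulmxDr !mulmxA GH mul1mx.
have {E'}E' : G^T *m (dlsubmx K *m G) =
    C - (A^T *m (G^T *m N) - (G^T *m N) *m A).
  by rewrite opprB [RHS]addrA [C + _]addrC -E' addrK.
split=> [K0|E0]; last first.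
  apply: (can_inj (mulmxK uG)); apply: (can_inj (mulKmx uGt)).
  by rewrite E' E0 subrr mul0mx mulmx0.
by apply/eqP; rewrite -subr_eq0 -E' K0 mul0mx mulmx0.
Qed.

(** Symmetry of [G^T N] and [G^T H = 1] say that the Jacobian is a symplectic matrix; congruence by
    an invertible matrix is injective, which identifies [w]. *)
Lemma sympl_transport G N H (w : 'M[R]_(n + n)) :
  G \in unitmx -> G^T *m H = 1%:M -> (G^T *m N)^T = G^T *m N ->
  sympl_mx = (block_mx G 0 N H)^T *m w *m block_mx G 0 N H ->
  w = sympl_mx.
Proof.
move=> uG GH Ssym; set M := block_mx _ _ _ _.
have uM : M \in unitmx.
  rewrite unitmxE det_lblock unitrM -!unitmxE uG.
  by have [_ ->] := mulmx1_unit GH.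
have EJ : M^T *m sympl_mx *m M = sympl_mx.
  rewrite /M /sympl_mx tr_block_mx !mulmx_block trmx0.
  rewrite !(mulmxN, mulNmx, mulmx0, mul0mx, mulmx1, oppr0, addr0, add0r).
  rewrite GH -[N^T *m G]trmxK trmx_mul trmxK Ssym addNr.
  by rewrite -[H^T *m G]trmxK trmx_mul trmxK GH trmx1.
rewrite -{1}EJ => /(can_inj (mulmxK uM)).
by move/(can_inj (mulKmx _)) => ->//; rewrite unitmx_tr.
Qed.

Lemma is_diag_lift T C : is_diag_mx T ->
  is_diag_mx (block_mx T 0 C T) <-> C = 0.
Proof.
move=> dT; split=> [/is_diag_mxP d|->].
  apply/matrixP => i j; rewrite mxE -(block_mxEdl T 0 C T); apply: d.
  by rewrite neq_ltn /= (ltn_addr _ (ltn_ord j)) orbT.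
by rewrite is_diag_block_mx // dT !eqxx.
Qed.

End LiftBlocks.

(** * Charts *)

Section Charts.
Variables (R : realType) (m : nat).

Lemma open_preimage_within (T1 T2 : topologicalType) (A : set T1) (B : set T2)
    (g : T1 -> T2) :
  open A -> (forall x, A x -> {for x, continuous g}) -> open B ->
  open (A `&` g @^-1` B).
Proof.
move=> oA cg oB; rewrite openE => x [Ax Bx].
have nA : nbhs x A by exact: open_nbhs_nbhs.
have nB : nbhs x (g @^-1` B).
  by apply: (cg x Ax); exact: open_nbhs_nbhs.
exact: filterI.
Qed.

Lemma Ck_row_continuous l U (f : 'rV[R]_m -> 'rV[R]_l) x :
  smooth_mx U f -> U x -> {for x, continuous f}.
Proof.
move=> sf Ux; apply: continuous_row => j; exact: Ck_continuous (sf 0 j 0) Ux.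
Qed.

Lemma smooth_comp l p (U : set 'rV[R]_m) (V : set 'rV[R]_l)
    (f : 'rV[R]_l -> 'rV[R]_p) (g : 'rV[R]_m -> 'rV[R]_l) :
  open U -> (forall x, U x -> V (g x)) -> smooth_mx V f -> smooth_mx U g ->
  smooth_mx U (f \o g).
Proof.
move=> oU gU sf sg i j k.
by apply: (Ck_comp (f := fun y => f y i j) oU gU) => [|j']; [exact: sf|exact: sg].
Qed.

Lemma smooth_sub l p (U V : set 'rV[R]_m) (f : 'rV[R]_m -> 'M[R]_(l, p)) :
  V `<=` U -> smooth_mx U f -> smooth_mx V f.
Proof. by move=> VU sf i j k; exact: Ck_sub VU (sf i j k). Qed.

Lemma cimg_cdom (M : topologicalType) (c : chart R m M) x :
  is_chart c -> cimg c x -> cdom c (cinv c x) /\ cmap c (cinv c x) = x.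
Proof. by move=> [_ _ cK _ _] [u cu <-]; rewrite cK. Qed.

Lemma open_overlap (M : topologicalType) (c d : chart R m M) :
  is_chart c -> is_chart d -> open (overlap c d).
Proof.
move=> hc hd; have [_ oc cK _ cc] := hc; have [od _ _ _ _] := hd.
rewrite (_ : overlap c d = cimg c `&` cinv c @^-1` cdom d).
  exact: open_preimage_within.
rewrite eqEsubset; split=> [_ [u [cu du] <-]|x [cx dx]].
  by split; [exists u|rewrite /= cK].
have [cu E] := cimg_cdom hc cx.
by exists (cinv c x).
Qed.

Variable X : manifold R m.

Definition change_chart (c : chart R m X) (W : set 'rV[R]_m)
    (Phi Psi : 'rV[R]_m -> 'rV[R]_m) : chart R m X :=
  Chart (cdom c `&` cmap c @^-1` W) (Phi \o cmap c) (cinv c \o Psi).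

(** By maximality it suffices to be compatible with every chart [e] of the atlas, and the
    transitions factor through [c] as [transition c e \o Psi] and [Phi \o transition e c]. *)
Lemma atlas_change_chart (c : chart R m X) W Phi Psi :
  atlas c -> open W -> W `<=` cimg c -> open (Phi @` W) ->
  (forall x, W x -> Psi (Phi x) = x) ->
  smooth_mx W Phi -> smooth_mx (Phi @` W) Psi ->
  atlas (change_chart c W Phi Psi).
Proof.
move=> ac oW Wc oPW PsiK sPhi sPsi; set d := change_chart _ _ _ _.
have hc := atlas_chart ac; have [oc _ cK cc ci] := hc.
have imgd : cimg d = Phi @` W.
  rewrite eqEsubset; split=> [_ [u [cu Wu] <-]|_ [x Wx <-]].
    by exists (cmap c u).
  have [cu E] := cimg_cdom hc (Wc _ Wx).
  by exists (cinv c x); [split=> //=; rewrite E|rewrite /= E].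
have hd : is_chart d.
  split.
  - exact: open_preimage_within.
  - by rewrite imgd.
  - by move=> u [cu Wu] /=; rewrite PsiK // cK.
  - move=> u [cu Wu]; apply: (@continuous_comp _ _ _ (cmap c) Phi).
      exact: cc.
    exact: Ck_row_continuous sPhi Wu.
  - move=> y; rewrite imgd => PWy; apply: (@continuous_comp _ _ _ Psi (cinv c)).
      exact: Ck_row_continuous sPsi PWy.
    by case: PWy => x Wx <-; rewrite PsiK //; apply/ci/Wc.
apply: (atlas_maximal hd) => e ae; have he := atlas_chart ae.
have [_ _ eK _ _] := he.
have [ce ec] := atlas_compatible ac ae.
split.
  apply: (@smooth_comp _ _ _ _ (transition c e) Psi (open_overlap hd he) _ ce).
    move=> _ [u [[cu Wu] eu] <-] /=; rewrite PsiK //.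
    by exists u.
  apply: smooth_sub sPsi; rewrite -imgd => _ [u [du _] <-].
  by exists u.
apply: (@smooth_comp _ _ _ _ Phi (transition e c) (open_overlap he hd) _ sPhi).
  move=> _ [u [eu [cu Wu]] <-].
  by rewrite /transition /= eK.
apply: smooth_sub ec => _ [u [eu [cu _]] <-].
by exists u.
Qed.

End Charts.

(** * The projection of phase space to positions *)

Section Projection.
Variables (R : realType) (n p : nat).

(** Keeping the momentum of [x] and moving only the position, the sup norm distance to [x] is that
    of the positions. *)
Lemma open_lsubmx_image (O : set 'rV[R]_(n + p)) :
  open O -> open [set lsubmx x | x in O].
Proof.
move=> oO; rewrite openE => _ [x Ox <-].
have /nbhs_ballP[d /= d0 dO] : nbhs x O by exact: open_nbhs_nbhs.
apply/nbhs_ballP; exists d => //= q xq.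
exists (row_mx q (rsubmx x)); last by rewrite row_mxKl.
apply: dO; move: xq; rewrite -!ball_normE /=; apply: le_lt_trans.
rewrite -{1}[x]hsubmxK opp_row_mx add_row_mx subrr.
apply: norm_row_le => // j; rewrite mxE.
by case: splitP => k _; [exact: norm_coord|rewrite mxE normr0].
Qed.

Lemma partial_lsubmx (g : 'rV[R]_n -> R) (i : 'I_n) x :
  partial (lshift p i) (fun y : 'rV[R]_(n + p) => g (lsubmx y)) x
    = partial i g (lsubmx x).
Proof.
rewrite /partial /derive (_ : (fun h => _) = (fun h : R =>
  h^-1 *: ((g \o shift (lsubmx x)) (h *: delta_mx 0 i) - g (lsubmx x))))//.
apply/funext => h /=; congr (_ *: (g _ - _)).
by apply/rowP => j; rewrite !mxE; congr (_ * _%:R + _).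
Qed.

Lemma partial_rshift_lsubmx (g : 'rV[R]_n -> R) (i : 'I_p) x :
  partial (rshift n i) (fun y : 'rV[R]_(n + p) => g (lsubmx y)) x = 0.
Proof.
rewrite -(derive0 g (lsubmx x)).
rewrite /partial /derive (_ : (fun h => _) = (fun h : R =>
  h^-1 *: ((g \o shift (lsubmx x)) (h *: 0) - g (lsubmx x))))//.
apply/funext => h /=; congr (_ *: (g _ - _)).
by apply/rowP => j; rewrite !mxE eq_lrshift mulr0.
Qed.

Lemma Ck_lsubmx k (U : set 'rV[R]_(n + p)) (V : set 'rV[R]_n)
    (g : 'rV[R]_n -> R) :
  open U -> (forall x, U x -> V (lsubmx x)) -> Ck k V g ->
  Ck k U (fun x => g (lsubmx x)).
Proof.
move=> oU UV Cg; apply: (Ck_comp oU UV Cg) => j.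
by under eq_fun do rewrite mxE; exact: Ck_coord.
Qed.

End Projection.

(** * The canonical transformation generated by F_2 *)

Section CotangentLift.
Variables (R : realType) (n : nat) (lam : 'I_n -> 'rV[R]_n -> R).

Definition lam_row (q : 'rV[R]_n) : 'rV[R]_n := \row_i lam i q.

Definition lam_jac (q : 'rV[R]_n) : 'M[R]_n := \matrix_i grad (lam i) q.

(* Solving [p_j = d F_2 / d q^j] for [P]. *)
Definition mom (x : 'rV[R]_(n + n)) : 'rV[R]_n :=
  rsubmx x *m invmx (lam_jac (lsubmx x)).

Definition lift_map (x : 'rV[R]_(n + n)) : 'rV[R]_(n + n) :=
  row_mx (lam_row (lsubmx x)) (mom x).

Definition lift_inv (S : 'rV[R]_n -> 'rV[R]_n) (y : 'rV[R]_(n + n)) :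
    'rV[R]_(n + n) :=
  row_mx (S (lsubmx y)) (rsubmx y *m lam_jac (S (lsubmx y))).

Lemma lift_map_inv (S : 'rV[R]_n -> 'rV[R]_n) x :
  lam_jac (lsubmx x) \in unitmx ->
  S (lam_row (lsubmx x)) = lsubmx x -> lift_inv S (lift_map x) = x.
Proof.
move=> uG E; rewrite /lift_inv /lift_map /mom row_mxKl row_mxKr E mulmxKV//.
exact: hsubmxK.
Qed.

Variable U : set 'rV[R]_n.
Hypotheses (oU : open U) (slam : forall i, smooth U (lam i)).

Lemma lam_jacE q i j : lam_jac q i j = partial j (lam i) q.
Proof. by rewrite !mxE. Qed.

Lemma smooth_lam_row : smooth_mx U lam_row.
Proof. by move=> i j k; under eq_fun do rewrite mxE; exact: slam. Qed.

Lemma smooth_lam_jac : smooth_mx U lam_jac.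
Proof.
move=> i j k; under eq_fun do rewrite lam_jacE.
by have [_] := slam i k.+1; exact.
Qed.

Lemma jac_lam_row q : U q -> jac lam_row q = lam_jac q.
Proof.
move=> Uq; rewrite jacE => [|j]; last first.
  by have [d _] := smooth_lam_row 0 j 1; exact: d.
apply/matrixP => i j; rewrite mxE lam_jacE; by apply: eq_partial => y; rewrite mxE.
Qed.

Variables (W : set 'rV[R]_(n + n)).
Hypotheses (oW : open W) (WU : forall x, W x -> U (lsubmx x))
  (uW : forall x, W x -> lam_jac (lsubmx x) \in unitmx).

Let C_jac k i j : Ck k W (fun x => lam_jac (lsubmx x) i j).
Proof.
exact: (Ck_lsubmx (g := fun q => lam_jac q i j) oW WU (smooth_lam_jac i j k)).
Qed.

Lemma smooth_lift_map : smooth_mx W lift_map.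
Proof.
move=> i j k; rewrite ord1 /lift_map.
case: (split_ordP j) => j' ->.
  under eq_fun do rewrite row_mxEl mxE.
  exact: Ck_lsubmx oW WU (slam j' k).
under eq_fun do rewrite row_mxEr mxE.
apply: Ck_sum => // l; apply: CkM => //.
  by under eq_fun do rewrite mxE; exact: Ck_coord.
exact: (Ck_invmx (F := fun x => lam_jac (lsubmx x)) oW uW (C_jac k)).
Qed.

(** The inverse matrix inside [mom] is never differentiated. In [p = mom G], the derivatives along
    [p] give [G^T H = 1]; those along [q] vanish on the left and express [G^T N] by Hessians. *)
Lemma jac_lift_map x : W x -> exists N H : 'M[R]_n,
  [/\ jac lift_map x = block_mx (lam_jac (lsubmx x)) 0 N H,
      (lam_jac (lsubmx x))^T *m H = 1%:M
    & forall k j, ((lam_jac (lsubmx x))^T *m N) k j =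
        - \sum_i mom x 0 i * partial j (partial k (lam i)) (lsubmx x)].
Proof.
move=> Wx; set G := lam_jac (lsubmx x).
have dlift j : differentiable (fun y => lift_map y 0 j) x.
  by have [d _] := smooth_lift_map 0 j 1; exact: d.
have dP i : differentiable (fun y => mom y 0 i) x.
  have := dlift (rshift n i); congr (differentiable _ _).
  by apply/funext => y; rewrite row_mxEr.
have dG i k : differentiable (fun y : 'rV[R]_(n + n) => lam_jac (lsubmx y) i k) x.
  by have [d _] := C_jac 1 i k; exact: d.
(* Differentiate [p = mom G]. *)
have pPG j k : ((rshift n k == j)%:R : R) =
    \sum_i (mom x 0 i * partial j (fun y => lam_jac (lsubmx y) i k) x +
            G i k * partial j (fun y => mom y 0 i) x).
  rewrite eq_sym -(partial_coord j (rshift n k) x).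
  rewrite (partial_ext j oW Wx
    (g := fun y => \sum_i mom y 0 i * lam_jac (lsubmx y) i k)).
    rewrite partial_sum => [|i]; last exact: differentiableM.
    by apply: eq_bigr => i _; rewrite partialM.
  move=> y Wy; have /rowP/(_ k) : rsubmx y = mom y *m lam_jac (lsubmx y).
    by rewrite /mom mulmxKV //; exact: uW.
  by rewrite !mxE.
pose N := \matrix_(i, j) partial (lshift n j) (fun y => mom y 0 i) x.
pose H := \matrix_(i, j) partial (rshift n j) (fun y => mom y 0 i) x.
exists N, H; split.
- rewrite jacE//; apply/matrixP => i j; rewrite mxE.
  have upper i' j' : partial j' (fun y => lift_map y 0 (lshift n i')) x
      = partial j' (fun y : 'rV[R]_(n + n) => lam i' (lsubmx y)) x.
    by apply: eq_partial => y; rewrite row_mxEl mxE.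
  have lower i' j' : partial j' (fun y => lift_map y 0 (rshift n i')) x
      = partial j' (fun y => mom y 0 i') x.
    by apply: eq_partial => y; rewrite row_mxEr.
  case: (split_ordP i) => i' ->; case: (split_ordP j) => j' ->.
  + by rewrite block_mxEul upper partial_lsubmx lam_jacE.
  + by rewrite block_mxEur upper partial_rshift_lsubmx mxE.
  + by rewrite block_mxEdl lower mxE.
  + by rewrite block_mxEdr lower mxE.
- apply/matrixP => k j; have E := pPG (rshift n j) k.
  rewrite eq_rshift in E; rewrite [RHS]mxE E mxE; apply: eq_bigr => i _.
  by rewrite (partial_rshift_lsubmx (fun q => lam_jac q i k)) mulr0 add0r !mxE.
move=> k j; have := pPG (lshift n j) k.
rewrite eq_rlshift big_split /= => /esym/eqP; rewrite addrC addr_eq0 => /eqP E.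
rewrite mxE (eq_bigr (fun i => G i k *
  partial (lshift n j) (fun y => mom y 0 i) x)) => [|i _]; last first.
  by congr (_ * _); rewrite mxE.
rewrite E; congr (- _); apply: eq_bigr => i _; congr (_ * _).
rewrite (partial_lsubmx (fun q => lam_jac q i k)).
by apply: eq_partial => q; rewrite lam_jacE.
Qed.

Lemma lift_hessian_sym x (T : 'M[R]_n) : W x ->
  (forall k j, T k j =
     - \sum_i mom x 0 i * partial j (partial k (lam i)) (lsubmx x)) -> T^T = T.
Proof.
move=> Wx TE; apply/matrixP => i j; rewrite mxE (TE i j) (TE j i).
have E l := partialC i j oU (WU Wx) (slam l 2).
by apply: congr1; apply: eq_bigr => l _; apply: congr1; exact: E.
Qed.

(* Differentiating [grad lam_l A = lam_l grad lam_l] along [q] and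
   antisymmetrizing cancels the right-hand side. *)
Lemma complete_lift_hessian (A : 'rV[R]_(n + n) -> 'M[R]_n) x (T : 'M[R]_n) :
  W x -> smooth_mx W A ->
  (forall y i, W y -> grad (lam i) (lsubmx y) *m A y
                      = lam i (lsubmx y) *: grad (lam i) (lsubmx y)) ->
  (forall k j, T k j =
     - \sum_i mom x 0 i * partial j (partial k (lam i)) (lsubmx x)) ->
  complete_lift_block A x = (A x)^T *m T - T *m A x.
Proof.
move=> Wx sA eigA TE; have Tsym := lift_hessian_sym Wx TE.
set q := lsubmx x.
have dA i j : differentiable (fun y => A y i j) x.
  by have [d _] := sA i j 1; exact: d.
have dG i k : differentiable (fun y : 'rV[R]_(n + n) => lam_jac (lsubmx y) i k) x.
  by have [d _] := C_jac 1 i k; exact: d.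
have dlam i : differentiable (fun y : 'rV[R]_(n + n) => lam i (lsubmx y)) x.
  by have [d _] := Ck_lsubmx oW WU (slam i 1); exact: d.
(* Component [i] of the eigenvector equation of [lam l], differentiated along [q^j]. The right-hand
   side is symmetric in [i] and [j] because the eigenvector is the gradient of its own
   eigenvalue. *)
have D l i j : \sum_k (lam_jac q l k * partial (lshift n j) (fun y => A y k i) x
      + A x k i * partial j (partial k (lam l)) q)
    = lam l q * partial j (partial i (lam l)) q
      + lam_jac q l i * lam_jac q l j.
  have Gd k : partial (lshift n j) (fun y => lam_jac (lsubmx y) l k) x
      = partial j (partial k (lam l)) q.
    rewrite (partial_lsubmx (fun q' => lam_jac q' l k)).
    by apply: eq_partial => q'; rewrite lam_jacE.
  have <- : partial (lshift n j)
      (fun y => \sum_k lam_jac (lsubmx y) l k * A y k i) x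
      = lam l q * partial j (partial i (lam l)) q
        + lam_jac q l i * lam_jac q l j.
    rewrite (partial_ext _ oW Wx
      (g := fun y => lam l (lsubmx y) * lam_jac (lsubmx y) l i)).
      by rewrite partialM// Gd partial_lsubmx -lam_jacE.
    move=> y Wy; have /rowP/(_ i) := eigA y l Wy.
    rewrite !mxE => <-; apply: eq_bigr => k _; by rewrite !mxE.
  rewrite partial_sum => [|k]; last exact: differentiableM.
  by apply: eq_bigr => k _; rewrite partialM// Gd.
apply/matrixP => i j; rewrite !mxE.
have pPG k : rsubmx x 0 k = \sum_l mom x 0 l * lam_jac q l k.
  have /rowP/(_ k) : rsubmx x = mom x *m lam_jac q.
    by rewrite /mom mulmxKV //; exact: uW.
  by rewrite !mxE.
(* The identities [D l] weighted by [mom x 0 l] and summed: [p = mom G] rebuilds the derivatives of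
   [A] weighted by [p], and the weighted Hessians sum to [- T]. *)
have half i' j' : \sum_k rsubmx x 0 k * partial (lshift n j') (fun y => A y k i') x
   = \sum_l mom x 0 l * (lam l q * partial j' (partial i' (lam l)) q
      + lam_jac q l i' * lam_jac q l j') + \sum_k (A x) k i' * T k j'.
  under eq_bigr do rewrite pPG mulr_suml.
  rewrite exchange_big /=.
  under [X in _ = _ + X]eq_bigr do rewrite TE mulrN mulr_sumr.
  rewrite sumrN [X in _ = _ - X]exchange_big /=.
  rewrite -sumrB; apply: eq_bigr => l _.
  rewrite -D mulr_sumr -sumrB; apply: eq_bigr => k _.
  move: (mom x 0 l) (lam_jac q l k) (partial _ _ _) (A x k i') (partial _ _ _).
  by move=> a b c d e; ring.
transitivity (\sum_k rsubmx x 0 k * partial (lshift n j) (fun y => A y k i) x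
  - \sum_k rsubmx x 0 k * partial (lshift n i) (fun y => A y k j) x).
  by rewrite -sumrB; apply: eq_bigr => k _; rewrite mulrBr.
rewrite !half opprD addrACA.
have -> : \sum_l mom x 0 l * (lam l q * partial j (partial i (lam l)) q
      + lam_jac q l i * lam_jac q l j) =
    \sum_l mom x 0 l * (lam l q * partial i (partial j (lam l)) q
      + lam_jac q l j * lam_jac q l i).
  by apply: eq_bigr => l _;
    rewrite (partialC i j oU (WU Wx) (slam l 2)) [X in _ + X]mulrC.
rewrite subrr add0r; congr (_ - _).
  by apply: eq_bigr => k _; rewrite mxE.
apply: eq_bigr => k _; rewrite mulrC; congr (_ * _).
by rewrite -{1}Tsym mxE.
Qed.

End CotangentLift.

Lemma jac_ext (R : realType) (m l : nat) (U : set 'rV[R]_m)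
    (f g : 'rV[R]_m -> 'rV[R]_l) x :
  open U -> U x -> (forall y, U y -> f y = g y) ->
  (forall j, differentiable (fun y => f y 0 j) x) -> jac f x = jac g x.
Proof.
move=> oU Ux fg df.
have dg j : differentiable (fun y => g y 0 j) x.
  by apply: near_eq_differentiable (df j); apply: open_near oU Ux _ => y /fg->.
rewrite (jacE df) (jacE dg); apply/matrixP => i j; rewrite !mxE.
by apply: partial_ext oU Ux _ => y /fg->.
Qed.

Lemma complete_lift_ext (R : realType) (n : nat) (O : set 'rV[R]_(n + n))
    (A A' : 'rV[R]_(n + n) -> 'M[R]_n) x :
  open O -> O x -> (forall y, O y -> A y = A' y) ->
  complete_lift_block A x = complete_lift_block A' x.
Proof.
move=> oO Ox AA'.
have E i j l : partial l (fun y => A y i j) x = partial l (fun y => A' y i j) x.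
  by apply: partial_ext oO Ox _ => y /AA'->.
apply/matrixP => i j; rewrite !mxE; apply: eq_bigr => k _.
by rewrite !E.
Qed.

(** * The chart [(Q, P)] and lift-form operators in it *)

Section LiftChart.
Variables (R : realType) (n : nat) (X : manifold R (n + n)).
Variables (w : symplectic_form X) (c : chart R (n + n) X).
Hypothesis cD : darboux w c.
Variable (lam : 'I_n -> 'rV[R]_n -> R).
Let U : set 'rV[R]_n := [set lsubmx x | x in cimg c].
Hypothesis slam : forall i, smooth U (lam i).
Variables (N : set 'rV[R]_n) (S : 'rV[R]_n -> 'rV[R]_n).
Hypotheses (oN : open N) (oQN : open (lam_row lam @` N))
  (NU : N `<=` U) (SK : forall q, N q -> S (lam_row lam q) = q)
  (uN : forall q, N q -> lam_jac lam q \in unitmx)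
  (sS : smooth_mx (lam_row lam @` N) S).

Let W : set 'rV[R]_(n + n) := cimg c `&` lsubmx @^-1` N.

Definition lift_chart : chart R (n + n) X :=
  change_chart c W (lift_map lam) (lift_inv lam S).

Let ac : atlas c. Proof. by case: cD. Qed.
Let hc : is_chart c. Proof. exact: atlas_chart ac. Qed.
Let oU : open U.
Proof. by apply: open_lsubmx_image; case: hc. Qed.
Let WU x : W x -> U (lsubmx x). Proof. by move=> [cx _]; exists x. Qed.
Let uW x : W x -> lam_jac lam (lsubmx x) \in unitmx.
Proof. by move=> [_ /uN]. Qed.

Let lsubmx_cont (x : 'rV[R]_(n + n)) :
  {for x, continuous (lsubmx : 'rV[R]_(n + n) -> 'rV[R]_n)}.
Proof. exact/differentiable_continuous/differentiable_lsubmx. Qed.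

Let oW : open W.
Proof.
have [_ oc _ _ _] := hc.
by apply: open_preimage_within oc _ oN => x _; exact: lsubmx_cont.
Qed.

Let sPhi : smooth_mx W (lift_map lam).
Proof. exact (smooth_lift_map slam oW WU uW). Qed.

(** The full cylinder over the image of the positions, on which [lift_inv] is smooth; [setT] only
    gives it the shape of [open_preimage_within]. *)
Let A : set 'rV[R]_(n + n) := setT `&` lsubmx @^-1` (lam_row lam @` N).

Let oA : open A.
Proof.
by apply: open_preimage_within openT _ oQN => x _; exact: lsubmx_cont.
Qed.

Let AS y : A y -> (lam_row lam @` N) (lsubmx y). Proof. by case. Qed.

Let sPsi : smooth_mx A (lift_inv lam S).
Proof.
have NS q : (lam_row lam @` N) q -> N (S q) by move=> [q' Nq' <-]; rewrite SK.
move=> i j k; rewrite ord1 /lift_inv; case: (split_ordP j) => j' ->.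
  under eq_fun do rewrite row_mxEl.
  exact: (Ck_lsubmx (g := fun q => S q 0 j') oA AS (sS 0 j' k)).
under eq_fun do rewrite row_mxEr mxE.
apply: Ck_sum => // l; apply: CkM => //.
  by under eq_fun do rewrite mxE; exact: Ck_coord.
have CG : Ck k N (fun q => lam_jac lam q l j').
  exact: Ck_sub NU (smooth_lam_jac slam l j' k).
exact: Ck_lsubmx oA AS (Ck_comp oQN NS CG (fun j'' => sS 0 j'' k)).
Qed.

(** Since [cimg c] need not be a product, the image is not a cylinder; as a preimage under the
    smooth inverse it is still open. *)
Let imgPhi : lift_map lam @` W = A `&` lift_inv lam S @^-1` cimg c.
Proof.
rewrite eqEsubset; split=> [_ [x Wx <-]|y [Ay cy]].
  have [cx Nx] := Wx; split; last first.
    by rewrite /= (lift_map_inv (uW Wx) (SK Nx)).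
  by split => //=; rewrite row_mxKl; exists (lsubmx x).
have [_ [q Nq Eq]] := Ay.
have SE : S (lsubmx y) = q by rewrite -Eq SK.
exists (lift_inv lam S y).
  by split => //=; rewrite row_mxKl SE.
rewrite /lift_map /mom /lift_inv row_mxKl row_mxKr SE Eq mulmxK ?hsubmxK//.
exact: uN.
Qed.

Lemma lift_chart_atlas : atlas lift_chart.
Proof.
apply: atlas_change_chart => //.
- by move=> x [].
- have [_ oc _ _ _] := hc; rewrite imgPhi; apply: open_preimage_within oA _ oc.
  by move=> y Ay; exact: Ck_row_continuous sPsi Ay.
- by move=> x Wx; exact: lift_map_inv (uW Wx) (SK Wx.2).
- by rewrite imgPhi; apply: smooth_sub sPsi => y [].
Qed.

Let dmapE u : cdom lift_chart u -> W (cmap c u) /\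
  cmap lift_chart u = lift_map lam (cmap c u).
Proof. by move=> [cu Wu]. Qed.

Let overlap_lift x : W x -> overlap c lift_chart x.
Proof.
move=> Wx; have [cu E] := cimg_cdom hc Wx.1.
by exists (cinv c x) => //; split=> //; split=> //=; rewrite E.
Qed.

Let transitionE x : cimg c x -> transition c lift_chart x = lift_map lam x.
Proof. by move=> cx; rewrite /transition /= (cimg_cdom hc cx).2. Qed.

Let jac_transition x : W x ->
  jac (transition c lift_chart) x = jac (lift_map lam) x.
Proof.
move=> Wx; apply/esym; apply: (jac_ext oW Wx).
  by move=> y [cy _]; rewrite transitionE.
by move=> j; have [d _] := sPhi 0 j 1; exact: d.
Qed.

Lemma lift_chart_darboux : darboux w lift_chart.
Proof.
split; first exact: lift_chart_atlas.
move=> _ [u /dmapE[Wx ->] <-]; move: Wx; set x := cmap c u => Wx.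
have [M [H [JE GH NE]]] := jac_lift_map slam oW WU uW Wx.
have := symplectic_law w ac lift_chart_atlas (overlap_lift Wx).
rewrite jac_transition// transitionE; last by case: Wx.
rewrite (cD.2 _ Wx.1) JE; apply: sympl_transport => //; first exact: uW.
exact: (lift_hessian_sym oU slam WU Wx NE).
Qed.

Lemma lift_chart_generates :
  generates (fun q P => \sum_i P 0 i * lam i q) c lift_chart.
Proof.
move=> u du /= j; have [Wx E] := dmapE du.
have dlam i : differentiable (lam i) (lsubmx (cmap c u)).
  by have [d _] := slam i 1; apply/d/WU.
split.
  rewrite partial_sum => [|i]; last first.
    by apply: differentiableM => //; exact: differentiable_cst.
  rewrite row_mxKr.
  set P := mom _ _.
  have /rowP/(_ j) : rsubmx (cmap c u) = P *m lam_jac lam (lsubmx (cmap c u)).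
    by rewrite /P /mom mulmxKV //; exact: uW.
  rewrite [X in _ = X -> _]mxE => ->.
  by apply: eq_bigr => i _; rewrite partialZ// lam_jacE.
rewrite row_mxKl mxE partial_sum => [|i]; last first.
  by apply: differentiableM; [exact: differentiable_coord|exact: differentiable_cst].
set q := lsubmx _.
have dE i Q : partial j (fun P : 'rV[R]_n => P 0 i * lam i q) Q
    = lam i q * (j == i)%:R.
  rewrite (eq_partial (g := fun P : 'rV[R]_n => lam i q * P 0 i)).
    by rewrite partialZ ?partial_coord//; exact: differentiable_coord.
  by move=> P; exact: mulrC.
under eq_bigr do rewrite dE.
rewrite (bigD1 j)//= eqxx mulr1 big1 ?addr0// => i /negbTE ij.
by rewrite eq_sym ij mulr0.
Qed.

(** Stated for any operator satisfying the eigenvector equation, so that a single chart can be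
    tested against all operators sharing an A-block. *)
Lemma lift_chart_components (K : tensor11 X) :
  symplectically_compatible w K -> lift_form K c ->
  (forall x i, cimg c x -> grad (lam i) (lsubmx x) *m Ablock K c x
         = lam i (lsubmx x) *: grad (lam i) (lsubmx x)) ->
  forall u, cdom lift_chart u ->
  let y := cmap lift_chart u in
  [/\ K lift_chart y = block_mx (diag_mx (lsubmx y)) 0
                         (Cblock K lift_chart y) (diag_mx (lsubmx y)),
      (Cblock K lift_chart y)^T = - Cblock K lift_chart y
    & Cblock K lift_chart y = 0 <->
      Cblock K c (cmap c u) = complete_lift_block (Ablock K c) (cmap c u)].
Proof.
move=> Kcomp Klift Keig u du y; have [Wx yE] := dmapE du.
rewrite /y yE; move: Wx; set x := cmap c u => Wx.
have yd : cimg lift_chart (lift_map lam x) by exists u.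
have [M [H [JE GH NE]]] := jac_lift_map slam oW WU uW Wx.
have [_ dD] := lift_chart_darboux.
have cc := Kcomp c x ac Wx.1.
rewrite /Omega (cD.2 _ Wx.1) in cc.
have cd := Kcomp lift_chart _ lift_chart_atlas yd.
rewrite /Omega (dD _ yd) in cd.
have law := tensor11_law K ac lift_chart_atlas (overlap_lift Wx).
rewrite jac_transition// transitionE in law; last by case: Wx.
have [Kdr _ _] := compatible_blocks cc.
have KcE : K c x = block_mx (Ablock K c x) 0 (Cblock K c x) (Ablock K c x)^T.
  by rewrite -Kdr -(Klift x Wx.1) submxK.
rewrite JE KcE in law.
have GA : lam_jac lam (lsubmx x) *m Ablock K c x =
    diag_mx (lsubmx (lift_map lam x)) *m lam_jac lam (lsubmx x).
  apply/row_matrixP => i; rewrite row_mul rowK Keig; last by case: Wx.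
  apply/rowP => j.
  by rewrite mul_diag_mx /lift_map row_mxKl !mxE.
have [E1 E2 E3] := lift_transport (uW Wx) GH GA (tr_diag_mx _) cd law.
split => //.
rewrite /Cblock in E3 *; rewrite E3.
rewrite -(complete_lift_hessian oU slam oW WU uW Wx _ _ NE) //.
- move=> i j k; under eq_fun do rewrite !mxE.
  apply: (@Ck_sub _ _ k (cimg c)); first by move=> z [].
  exact (tensor11_smooth K ac (lshift n i) (lshift n j) k).
- by move=> z i [cz _]; exact: Keig.
Qed.

End LiftChart.

(** Dependence on the A-block only is expressed by the order of quantifiers: [d] is fixed before
    [K']. What is left of [K'] in [d] is a skew block, and it vanishes for exactly one choice of
    [C], itself computed from [A]. *)
Theorem proposition2 (R : realType) (n : nat) (X : manifold R (n + n))
    (w : symplectic_form X) (K : tensor11 X) (c : chart R (n + n) X)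
    (K_haantjes : haantjes_operator K)
    (K_compatible : symplectically_compatible w K)
    (c_darboux : darboux w c)
    (K_lift : lift_form K c) :
  (forall x, cimg c x ->
    let A := Ablock K c x in let C := Cblock K c x in
    [/\ K c x = block_mx A 0 C A^T,
        C^T = - C,
        [/\ forall l : R, \det (K c x - l%:M) = \det (A - l%:M) ^+ 2,
            char_poly (K c x) = char_poly A ^+ 2
          & forall l : R, eigenvalue (K c x) l = eigenvalue A l]
      & forall (l : R) (s : 'rV[R]_n), left_eigenvector A l s ->
          [/\ left_eigenvector (K c x) l (row_mx s 0),
              right_eigenvector (K c x)^T l (col_mx s^T 0)
            & characteristic_covector (K c x) l (col_mx s^T 0)]])
  /\
  (forall (lam : 'I_n -> 'rV[R]_n -> R) (u0 : X),
    cdom c u0 ->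
    (forall i, smooth [set lsubmx x | x in cimg c] (lam i)) ->
    (forall x, cimg c x ->
       char_poly (Ablock K c x) = \prod_i ('X - (lam i (lsubmx x))%:P)) ->
    (forall x i, cimg c x ->
       grad (lam i) (lsubmx x) *m Ablock K c x
         = lam i (lsubmx x) *: grad (lam i) (lsubmx x)) ->
    (\matrix_i grad (lam i) (lsubmx (cmap c u0))) \in unitmx ->
    exists d : chart R (n + n) X,
      [/\ cdom d u0 /\ cdom d `<=` cdom c,
          darboux w d,
          (forall u i, cdom d u ->
             lsubmx (cmap d u) 0 i = lam i (lsubmx (cmap c u))),
          generates (fun q P => \sum_i P 0 i * lam i q) c d
        & forall K' : tensor11 X,
            haantjes_operator K' -> symplectically_compatible w K' ->
            lift_form K' c ->
            (forall x, cimg c x -> Ablock K' c x = Ablock K c x) ->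
            (forall y, cimg d y ->
               [/\ K' d y = block_mx (diag_mx (lsubmx y)) 0
                                     (Cblock K' d y) (diag_mx (lsubmx y))
                 & (Cblock K' d y)^T = - Cblock K' d y])
            /\
            (darboux_haantjes w K' d <->
             forall u, cdom d u ->
               Cblock K' c (cmap c u)
                 = complete_lift_block (Ablock K c) (cmap c u))]).
Proof.
have hcK (K' : tensor11 X) x : symplectically_compatible w K' ->
    lift_form K' c -> cimg c x ->
    K' c x = block_mx (Ablock K' c x) 0 (Cblock K' c x) (Ablock K' c x)^T /\
    (Cblock K' c x)^T = - Cblock K' c x.
  move=> Kc Kl cx; have := Kc c x c_darboux.1 cx.
  rewrite /Omega (c_darboux.2 _ cx) => /compatible_blocks[Kdr _ Kdl].
  by split => //; rewrite -Kdr -(Kl x cx) submxK.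
split.
  move=> x cx A C; have [KE CE] := hcK K x K_compatible K_lift cx.
  rewrite KE; split => //.
    by split; [exact: det_lift|exact: char_poly_lift|exact: eigenvalue_lift].
  move=> l s As; have Ks := left_eigenvector_lift C As.
  have := left_eigenvector_tr Ks.
  by rewrite tr_row_mx trmx0 => -[].
move=> lam u0 cu0 slam _ lam_eig ulam.
set U := [set lsubmx x | x in cimg c] in slam.
have hc := atlas_chart c_darboux.1.
have oU : open U by apply: open_lsubmx_image; case: hc.
have Ua : U (lsubmx (cmap c u0)) by exists (cmap c u0) => //; exists u0.
have ujac : jac (lam_row lam) (lsubmx (cmap c u0)) \in unitmx.
  by rewrite (jac_lam_row slam).
have [N [S [[oN Na] NU oQN SN sS]]] :=
  inverse_function oU Ua (smooth_lam_row slam) ujac.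
have SK q : N q -> S (lam_row lam q) = q by move=> /SN[].
have uN q : N q -> lam_jac lam q \in unitmx.
  by move=> Nq; have [_] := SN q Nq; rewrite (jac_lam_row slam)//; exact: NU.
pose d := lift_chart c lam N S.
have dD : darboux w d := lift_chart_darboux c_darboux slam oN oQN NU SK uN sS.
exists d; split.
- split; last by move=> u [].
  by split => //; split => //; exists u0.
- exact: dD.
- by move=> u i [cu Wu]; rewrite /= row_mxKl mxE.
- exact: (lift_chart_generates slam uN).
move=> K' _ K'c K'l K'A.
have K'eig x i : cimg c x -> grad (lam i) (lsubmx x) *m Ablock K' c x
    = lam i (lsubmx x) *: grad (lam i) (lsubmx x).
  by move=> cx; rewrite K'A//; exact: lam_eig.
have comp := lift_chart_components c_darboux slam oN oQN NU SK uN sS K'c K'l K'eig.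
(* The block contains derivatives of [A], so agreement on the whole open image of [c] is used, not
   only at one point. *)
have cliftE u : cdom c u -> complete_lift_block (Ablock K' c) (cmap c u)
    = complete_lift_block (Ablock K c) (cmap c u).
  move=> cu; have [_ oc _ _ _] := hc.
  by apply: complete_lift_ext oc _ K'A; exists u.
split=> [_ [u du <-]|]; first by have [] := comp u du.
split=> [[_ Kdiag] u du|KC].
  have [E1 _ E3] := comp u du.
  rewrite -cliftE; last by case: du.
  apply/E3/(is_diag_lift _ (diag_mx_is_diag (lsubmx (cmap d u)))).
  by rewrite -E1; apply: Kdiag; exists u.
split=> // _ [u du <-]; have [E1 _ E3] := comp u du.
rewrite E1; apply/is_diag_lift; first exact: diag_mx_is_diag.
by apply/E3; rewrite KC// cliftE//; case: du.
Qed.
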